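(* Let $\mathfrak{L}$ be a finite-dimensional semi-simple left Leibniz algebra over a field of characteristic zero. If $M$ is a finite-dimensional $\mathfrak{L}$-bimodule such that $M^{\mathfrak{L}}=0$, then $\mathrm{HL}^n(\mathfrak{L},M)=0$ for every non-negative integer $n$.
   Context: A left Leibniz algebra over $\mathbb{F}$ is a vector space $\mathfrak{L}$ with bilinear product satisfying $x(yz)=(xy)z+y(xz)$. $\mathrm{Leib}(\mathfrak{L})=\langle x^2\mid x\in\mathfrak{L}\rangle_{\mathbb{F}}$ and $\mathfrak{L}_{\mathrm{Lie}}=\mathfrak{L}/\mathrm{Leib}(\mathfrak{L})$. $\mathfrak{L}$ is semi-simple if $\mathrm{Leib}(\mathfrak{L})$ contains every solvable ideal of $\mathfrak{L}$ (equivalently $\mathfrak{L}_{\mathrm{Lie}}$ is semi-simple). An $\mathfrak{L}$-bimodule is a vector space $M$ with bilinear actions $x\cdot m$, $m\cdot x$ satisfying $(xy)\cdot m=x\cdot(y\cdot m)-y\cdot(x\cdot m)$, $(x\cdot m)\cdot y=x\cdot(m\cdot y)-m\cdot(xy)$, $(m\cdot x)\cdot y=m\cdot(xy)-x\cdot(m\cdot y)$. $M^{\mathfrak{L}}:=\{m\in M\mid m\cdot x=0\ \forall x\in\mathfrak{L}\}$ (right invariants). Leibniz cohomology $\mathrm{HL}^n(\mathfrak{L},M)$ is the cohomology of $\mathrm{CL}^n(\mathfrak{L},M)=\mathrm{Hom}_{\mathbb{F}}(\mathfrak{L}^{\otimes n},M)$ with coboundary $(\mathrm{d}^nf)(x_1,\dots,x_{n+1})=\sum_{i=1}^n(-1)^{i+1}x_i\cdot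 f(\dots,\hat{x}_i,\dots)+(-1)^{n+1}f(x_1,\dots,x_n)\cdot x_{n+1}+\sum_{i<j}(-1)^if(x_1,\dots,\hat{x}_i,\dots,x_ix_j,\dots,x_{n+1})$, with $x_ix_j$ in the $j$-th position. *)

(* Defs.v *)
From HB Require Import structures.
From mathcomp Require Import all_boot all_order all_algebra.
Set Implicit Arguments. Unset Strict Implicit. Unset Printing Implicit Defensive.
Import GRing.Theory.
Local Open Scope ring_scope.

Section Leibniz.
Variable F : fieldType.
Variable L : vectType F.
Variable M : vectType F.
Variable mul : L -> L -> L.
Variable lact : L -> M -> M.
Variable ract : M -> L -> M.

Definition bilinear_map (A B C : lmodType F) (h : A -> B -> C) :=
  (forall a x y z, h (a *: x + y) z = a *: h x z + h y z) /\
  (forall a x y z, h z (a *: x + y) = a *: h z x + h z y).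

Definition left_leibniz :=
  forall x y z, mul x (mul y z) = mul (mul x y) z + mul y (mul x z).

Definition bimodule_axioms :=
  bilinear_map lact /\ bilinear_map ract /\
  (forall x y m, lact (mul x y) m = lact x (lact y m) - lact y (lact x m)) /\
  (forall x y m, ract (lact x m) y = lact x (ract m y) - ract m (mul x y)) /\
  (forall x y m, ract (ract m x) y = ract m (mul x y) - lact x (ract m y)).

Definition is_product_space (U V W : {vspace L}) :=
  (forall u v, u \in U -> v \in V -> mul u v \in W) /\
  (forall W' : {vspace L},
     (forall u v, u \in U -> v \in V -> mul u v \in W') -> (W <= W')%VS).

Definition is_ideal (I : {vspace L}) :=
  forall x y, y \in I -> mul x y \in I /\ mul y x \in I.

Definition is_solvable (I : {vspace L}) :=
  exists (D : nat -> {vspace L}) (k : nat),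
    D 0%N = I /\ (forall i, is_product_space (D i) (D i) (D i.+1)) /\
    D k = 0%VS.

(* V contains every square x^2; Leib(L) is the smallest such subspace *)
Definition contains_squares (V : {vspace L}) := forall x, mul x x \in V.

(* semi-simple: Leib(L) contains every solvable ideal *)
Definition leib_semisimple :=
  forall I : {vspace L}, is_ideal I -> is_solvable I ->
    forall V : {vspace L}, contains_squares V -> (I <= V)%VS.

Definition right_invariants_trivial :=
  forall m : M, (forall x, ract m x = 0) -> m = 0.

(* Cochains in CL^n(L,M) = Hom(L^{(x)n}, M) are represented by functions
   f : seq L -> M, only evaluated on lists of length n, that are
   multilinear in the n arguments. *)
Definition multilinear (n : nat) (f : seq L -> M) :=
  forall (s : seq L), size s = n -> forall i, (i < n)%N ->
  forall (a : F) (x y : L),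
    f (set_nth 0 s i (a *: x + y)) = a *: f (set_nth 0 s i x) + f (set_nth 0 s i y).

Definition rem_at (i : nat) (s : seq L) := take i s ++ drop i.+1 s.

(* the Leibniz coboundary d^n f, evaluated on s = [x_1; ...; x_{n+1}]
   (0-indexed positions 0..n) *)
Definition cobound (n : nat) (f : seq L -> M) (s : seq L) : M :=
  \sum_(i < n) ((-1) ^+ i : F) *: lact (nth 0 s i) (f (rem_at i s))
  + ((-1) ^+ n.+1 : F) *: ract (f (take n s)) (nth 0 s n)
  + \sum_(i < n.+1) \sum_(j < n.+1 | (i < j)%N)
      ((-1) ^+ i.+1 : F) *:
        f (rem_at i (set_nth 0 s j (mul (nth 0 s i) (nth 0 s j)))).

Definition is_cocycle (n : nat) (f : seq L -> M) :=
  forall s, size s = n.+1 -> cobound n f s = 0.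

Definition HL_vanishes (n : nat) :=
  forall f, multilinear n f -> is_cocycle n f ->
  match n with
  | 0%N => forall s, size s = 0%N -> f s = 0
  | n'.+1 => exists g, multilinear n' g /\
                forall s, size s = n -> f s = cobound n' g s
  end.

End Leibniz.

(* Main.v *)
Require Import Defs.
From HB Require Import structures.
From mathcomp Require Import all_boot all_order all_algebra all_field.
From mathcomp Require Import ring.
From Stdlib Require Import Classical.
Set Implicit Arguments. Unset Strict Implicit. Unset Printing Implicit Defensive.
Import GRing.Theory Num.Theory.
Local Open Scope ring_scope.

(* Since [x.m + m.x] is always right invariant, the hypothesis makes [M]      *)
(* symmetric, so the cochain spaces are left modules under an action [theta]  *)
(* satisfying Cartan's formula [d i_x + i_x d = theta_x]. Every finite-       *)
(* dimensional left module [V] splits as [V^L + L V]: the trace form of [V]   *)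
(* has radical exactly the kernel of the action (Cartan's criterion), its     *)
(* Casimir element [c] has nonzero trace, hence is not nilpotent, and one     *)
(* inducts on the Fitting null component of [c]. Now let [f] be an            *)
(* [n.+1]-cocycle. As [L] acts on cocycles by coboundaries, [f] may be taken  *)
(* invariant; then each [f x] is an [n]-cocycle, so by induction              *)
(* [f x = d (h x)] with [h] invariant, and Cartan's formula for [h] reads     *)
(* [f = - d h].                                                               *)

(** * Splitting fields, Chinese remainders and traces *)

(** The cohomological induction is [cochain_d_vanish], carried out on curried cochains;
    [ev_cochain_d] identifies their differential with [cobound] once the bimodule is known to be
    symmetric. Semi-simplicity enters it through [module_decomposition]: a finite-dimensional left
    module is the direct sum of its invariants and of [L V]. That rests on [trace_radical], which
    makes [casimir_exists] applicable, and on [fitting_projection]. Behind [trace_radical] stands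
    [cartan_solvable], where [cartan_nilpotent] makes single matrices nilpotent and [engel] passes
    to their span. *)

Lemma irreducible_factor_exists (F : fieldType) (p : {poly F}) :
  (1 < size p)%N -> exists2 q, irreducible_poly q & q %| p.
Proof.
have [n] := ubnP (size p); elim: n p => // n IHn p le_pn p_gt1.
have p0 : p != 0 by rewrite -size_poly_gt0 ltnW.
case: (classic (irreducible_poly p)) => [irr_p | red_p]; first by exists p.
have [q [q1 qp nqp]] : exists q : {poly F}, [/\ size q != 1%N, q %| p & ~~ (q %= p)].
  apply: NNPP => H; apply: red_p; split=> // q q1 qp.
  by apply/negPn/negP => nqp; apply: H; exists q.
have ltqp : (size q < size p)%N.
  by rewrite ltn_neqAle dvdp_leq // andbT dvdp_size_eqp.
have q0 : q != 0 by apply: contraTneq qp => ->; rewrite dvd0p.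
have q_gt1 : (1 < size q)%N by rewrite ltn_neqAle eq_sym q1 size_poly_gt0.
have [|r irr_r rq] := IHn q _ q_gt1; first exact: leq_trans ltqp le_pn.
by exists r => //; apply: dvdp_trans qp.
Qed.

(** One root is adjoined at a time and its linear factor split off; the field grows, so the
    induction generalizes over [F]. *)
Lemma splitting_field_exists (F : fieldType) (p : {poly F}) : p != 0 ->
  exists (K : fieldType) (iota : {rmorphism F -> K}) (s : seq K),
    map_poly iota p %= \prod_(z <- s) ('X - z%:P).
Proof.
have [n] := ubnP (size p); elim: n F p => // n IHn F p le_pn p0.
have [p_le1 | p_gt1] := leqP (size p) 1.
  exists F, idfun, [::]; rewrite big_nil map_poly_id //.
  by rewrite -size_poly_eq1 eqn_leq p_le1 size_poly_gt0.
have [q irr_q qp] := irreducible_factor_exists p_gt1.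
have [L _ [z rz _]] := irredp_FAdjoin irr_q.
have : root (map_poly (in_alg L) p) z.
  by rewrite -dvdp_XsubCl (dvdp_trans _ (_ : map_poly (in_alg L) q %| _)) ?dvdp_map ?dvdp_XsubCl.
case/factor_theorem=> p1 Dp.
have : map_poly (in_alg L) p != 0 by rewrite map_poly_eq0.
rewrite Dp mulf_eq0 negb_or => /andP[p10 _].
have [|K [iota [s Ds]]] := IHn L p1 _ p10.
  rewrite -(size_map_poly (in_alg L)) Dp size_Mmonic ?monicXsubC // in le_pn.
  by rewrite size_XsubC addn2 in le_pn.
exists K, (iota \o in_alg L), (iota z :: s).
rewrite map_poly_comp /= Dp rmorphM /= map_polyXsubC big_cons mulrC.
by rewrite eqp_mull.
Qed.

Section PolynomialCRT.
Variable K : fieldType.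
Implicit Types (s : seq K) (p : {poly K}).

Lemma coprimep_prod_XsubC s d m : d \notin s ->
  coprimep (('X - d%:P) ^+ m) (\prod_(c <- s) ('X - c%:P) ^+ m).
Proof.
elim: s => [|c s IHs]; first by rewrite big_nil coprimep1.
rewrite inE negb_or big_cons coprimepMr => /andP[dc /IHs->]; rewrite andbT.
by apply/coprimep_expl/coprimep_expr/coprimep_XsubC2; rewrite subr_eq0 eq_sym.
Qed.

Lemma prod_XsubC_exp_dvdp s m p : uniq s ->
  {in s, forall d, ('X - d%:P) ^+ m %| p} ->
  \prod_(c <- s) ('X - c%:P) ^+ m %| p.
Proof.
elim: s => [|c s IHs]; first by rewrite big_nil dvd1p.
move=> /= /andP[cs us] H; rewrite big_cons Gauss_dvdp ?coprimep_prod_XsubC //.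
by rewrite H ?mem_head //= IHs // => d ds; apply: H; rewrite inE ds orbT.
Qed.

(** The sigma type, extracted by [xchoose] from a boolean statement, allows [spectral_idem] to be
    defined from it. *)
Lemma polynomial_crt s (v : K -> K) m : uniq s ->
  {p | {in s, forall d, ('X - d%:P) ^+ m %| p - (v d)%:P}}.
Proof.
move=> us; suff E : exists p, all (fun d => ('X - d%:P) ^+ m %| p - (v d)%:P) s.
  by exists (xchoose E); apply/allP/(xchooseP E).
elim: s us => [|d s IHs] /=; first by exists 0.
case/andP=> ds /IHs[p /allP Hp].
have /Bezout_eq1_coprimepP[[u w] /= uw1] := coprimep_prod_XsubC m ds.
set Q := \prod_(c <- s) _ in uw1.
(* By Bezout [w * Q] is 1 modulo the power of ['X - d%:P] and 0 modulo [Q], so [p] is corrected at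
   [d] only. *)
exists (p + w * Q * ((v d)%:P - p)); apply/andP; split; last first.
  apply/allP => c cs; rewrite addrAC dvdp_add ?Hp // -mulrA mulrCA dvdp_mulr //.
  by rewrite /Q (big_rem c cs) /= dvdp_mulr.
have -> : p + w * Q * ((v d)%:P - p) - (v d)%:P = (p - (v d)%:P) * (1 - w * Q).
  by ring.
by rewrite -uw1 addrK mulrA dvdp_mull.
Qed.

End PolynomialCRT.

Section Traces.
Variable F : fieldType.

(** Factor [A = C R] through its rank. Below full rank, [R C] is a smaller nilpotent matrix with the
    same trace; at full rank [A] is invertible and nilpotent, so [n] is 0. *)
Lemma mxtrace_nilpotent n (A : 'M[F]_n) k :
  iter k (mulmx A) 1%:M = 0 -> \tr A = 0.
Proof.
have [m] := ubnP n; elim: m n A k => // m IHm n A k le_nm A0.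
have [r_n | r_n] := eqVneq (\rank A) n.
  have uA : A \in unitmx by rewrite -row_full_unit -[row_full A]/(_ == _) r_n.
  have : iter k (mulmx A) 1%:M \in unitmx.
    by elim: k {A0} => [|k IHk] /=; rewrite ?unitmx1 // unitmx_mul uA.
  rewrite A0; case: n {le_nm r_n uA k A0} A => [|n] A.
    by rewrite (flatmx0 A) mxtrace0.
  by rewrite unitmxE det0 unitr0.
have ltr : (\rank A < n)%N by rewrite ltn_neqAle r_n rank_leq_row.
rewrite -(mulmx_base A) mxtrace_mulC.
apply: (IHm _ _ k.+1); first exact: leq_trans ltr _.
have E j : iter j.+1 (mulmx (row_base A *m col_base A)) 1%:M =
    row_base A *m iter j (mulmx A) 1%:M *m col_base A.
  elim: j => [|j IHj]; first by rewrite /= !mulmx1.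
  have DA B : A *m B = col_base A *m (row_base A *m B).
    by rewrite mulmxA mulmx_base.
  by rewrite iterS IHj [in RHS]iterS DA !mulmxA.
by rewrite E A0 mulmx0 mul0mx.
Qed.

(** In a rank factorization [E = C R], idempotence forces [R C] to be the identity of size
    [\rank E], with the same trace as [E]. *)
Lemma mxtrace_idempotent n (E : 'M[F]_n) : E *m E = E -> \tr E = (\rank E)%:R.
Proof.
move=> EE; rewrite -{1}(mulmx_base E) mxtrace_mulC.
suff -> : row_base E *m col_base E = 1%:M by rewrite mxtrace1.
apply: (row_free_inj (row_base_free E)); rewrite mul1mx.
have /row_fullP[B BC] := col_base_full E.
have CRCR : col_base E *m (row_base E *m col_base E *m row_base E)
    = col_base E *m row_base E.
  rewrite -(mulmxA (row_base E)) mulmxA.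
  by rewrite !mulmx_base EE.
have := congr1 (mulmx B) CRCR.
by rewrite [B *m (_ *m _)]mulmxA BC mul1mx [RHS]mulmxA BC mul1mx.
Qed.

End Traces.

Lemma pchar0_natr_eq0 (K : fieldType) (n : nat) :
  [pchar K] =i pred0 -> n%:R = 0 :> K -> n = 0%N.
Proof. by move=> /pcharf0P K0 /eqP; rewrite K0 => /eqP. Qed.

Lemma pchar0_intr_eq0 (K : fieldType) (n : int) :
  [pchar K] =i pred0 -> n%:~R = 0 :> K -> n = 0.
Proof.
move=> K0; case: n => n; first by move/(pchar0_natr_eq0 K0)->.
by rewrite NegzE rmorphN /= => /eqP; rewrite oppr_eq0 => /eqP /(pchar0_natr_eq0 K0).
Qed.

(* A substitute for Q-linear functionals on the Q-span of the finite set [s]: *)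
(* an integer-valued function respecting all integer relations between them.  *)
Lemma integer_functional (K : fieldType) (s : seq K) (x : K) :
    [pchar K] =i pred0 -> uniq s -> x \in s -> x != 0 ->
  exists2 phi : K -> int, phi x != 0 &
    forall c : K -> int, \sum_(y <- s) (c y)%:~R * y = 0 ->
      \sum_(y <- s) c y * phi y = 0.
Proof.
move=> K0 us s_x x0; pose r := rem x s.
have ps : perm_eq s (rcons r x) by rewrite perm_sym perm_rcons perm_sym perm_to_rem.
have ur : uniq (rcons r x) by rewrite -(perm_uniq ps).
suff [phi phix Hphi] : exists2 phi : K -> int, phi x != 0 &
    forall c : K -> int, \sum_(y <- rcons r x) (c y)%:~R * y = 0 ->
      \sum_(y <- rcons r x) c y * phi y = 0.
  by exists phi => // c; rewrite !(perm_big _ ps); apply: Hphi.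
(* [x] stays last, so the induction starts from [phi x = 1] and treats one further element [t] at a
   time. *)
elim: r ur {ps} => [|t r IHr] /=.
  exists (fun=> 1) => // c; rewrite !big_seq1 mulr1 => /eqP.
  by rewrite mulf_eq0 (negPf x0) orbF => /eqP /(pchar0_intr_eq0 K0).
case/andP=> tr /IHr[phi phix Hphi].
have tx : x != t by apply: contraNneq tr => <-; rewrite mem_rcons mem_head.
(* If a nonzero multiple [m * t] is an integer combination of the others, the value at [t] is
   forced, and [phi] is scaled by [m] to keep it an integer. Otherwise [t] has coefficient 0 in
   every relation and may go to 0. *)
case: (classic (exists (m : int) (a : K -> int), m != 0 /\
    m%:~R * t = \sum_(y <- rcons r x) (a y)%:~R * y)) => [[m [a [m0 Ht]]] | nH].
  pose b := \sum_(z <- rcons r x) a z * phi z.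
  exists (fun y => if y == t then b else m * phi y).
    by rewrite (negPf tx) mulf_neq0.
  move=> c; rewrite !big_cons eqxx => Hc.
  rewrite (_ : \sum_(y <- _) _ = m * \sum_(y <- rcons r x) c y * phi y); last first.
    rewrite mulr_sumr !big_seq; apply: eq_bigr => y ry; rewrite ifN; first by ring.
    by apply: contraNneq tr => <-.
  have <- : \sum_(y <- rcons r x) (m * c y + c t * a y) * phi y =
      c t * b + m * \sum_(y <- rcons r x) c y * phi y.
    by rewrite !mulr_sumr -big_split; apply: eq_bigr => y _ /=; ring.
  apply: Hphi.
  have -> : \sum_(y <- rcons r x) (m * c y + c t * a y)%:~R * y =
      m%:~R * (\sum_(y <- rcons r x) (c y)%:~R * y)
      + (c t)%:~R * \sum_(y <- rcons r x) (a y)%:~R * y.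
    rewrite !mulr_sumr -big_split; apply: eq_bigr => y _ /=.
    by rewrite rmorphD !rmorphM /= mulrDl !mulrA.
  by rewrite -Ht mulrCA -mulrDr addrC Hc mulr0.
exists (fun y => if y == t then 0 else phi y); first by rewrite (negPf tx).
move=> c; rewrite !big_cons eqxx mulr0 add0r => Hc.
have ct : c t = 0.
  apply/eqP/negPn/negP => ct; apply: nH; exists (c t), (fun y => - c y); split=> //.
  apply/eqP; under eq_bigr => y _ do rewrite rmorphN mulNr.
  by rewrite sumrN -addr_eq0 Hc.
rewrite ct mul0r add0r in Hc; rewrite -[RHS](Hphi c Hc) !big_seq.
by apply: eq_bigr => y ry; rewrite ifN //; apply: contraNneq tr => <-.
Qed.

Section PolyAct.
Variables (K : comNzRingType) (V : lmodType K) (T : {linear V -> V}).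
Implicit Types (p : {poly K}) (v : V).

Definition polyact p v := \sum_(i < size p) p`_i *: iter i T v.

Lemma polyact_widen m p v : (size p <= m)%N ->
  polyact p v = \sum_(i < m) p`_i *: iter i T v.
Proof.
move=> le_pm; rewrite /polyact (big_ord_widen _ (fun i => p`_i *: iter i T v) le_pm).
rewrite big_mkcond; apply: eq_bigr => i _; case: ltnP => // le_pi.
by rewrite nth_default // scale0r.
Qed.

Lemma polyactD p q v : polyact (p + q) v = polyact p v + polyact q v.
Proof.
pose m := maxn (size p) (size q).
rewrite !(@polyact_widen m) ?leq_maxl ?leq_maxr ?size_polyD //.
by rewrite -big_split; apply: eq_bigr => i _; rewrite coefD scalerDl.
Qed.

Lemma polyactC c v : polyact c%:P v = c *: v.
Proof. by rewrite (@polyact_widen 1) ?size_polyC_leq1 // big_ord1 coefC. Qed.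

Lemma polyactMX p v : polyact (p * 'X) v = polyact p (T v).
Proof.
rewrite (@polyact_widen (size p).+1); last first.
  by rewrite (leq_trans (size_polyMleq _ _)) // size_polyX addn2.
rewrite big_ord_recl coefMX scale0r add0r; apply: eq_bigr => i _.
by rewrite coefMX /= -iterSr.
Qed.

Lemma polyact_linear p : linear (polyact p).
Proof.
move=> a u v; rewrite scaler_sumr -big_split; apply: eq_bigr => i _ /=.
have -> : iter i T (a *: u + v) = a *: iter i T u + iter i T v.
  by elim: (i : nat) => //= j ->; rewrite linearP.
by rewrite scalerDr !scalerA mulrC.
Qed.

Lemma polyactM_XsubC p d v : polyact (p * ('X - d%:P)) v = polyact p (T v - d *: v).
Proof.
rewrite mulrBr polyactD polyactMX -mulrN -polyCN.
have -> : polyact (p * (- d)%:P) v = - d *: polyact p v.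
  rewrite mulrC mul_polyC (@polyact_widen (size p)) ?size_scale_leq //.
  by rewrite /polyact scaler_sumr; apply: eq_bigr => i _; rewrite coefZ scalerA.
by rewrite -[in RHS]scaleNr [in RHS]addrC polyact_linear addrC.
Qed.

Lemma polyactM_XsubC_exp p d m v :
  polyact (p * ('X - d%:P) ^+ m) v = polyact p (iter m (fun u => T u - d *: u) v).
Proof.
elim: m v => [|m IHm] v; first by rewrite mulr1.
by rewrite exprS mulrCA mulrC polyactM_XsubC IHm -iterSr.
Qed.

End PolyAct.

(** * Cartan's nilpotency criterion *)

Definition ad (A : pzRingType) (x y : A) := x * y - y * x.

Lemma ad_is_linear (K : nzRingType) (A : algType K) (x : A) : linear (ad x).
Proof.
move=> a u v; rewrite /ad mulrDr mulrDl -scalerAr -scalerAl scalerBr.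
by rewrite opprD addrACA.
Qed.
HB.instance Definition _ (K : nzRingType) (A : algType K) (x : A) :=
  GRing.isLinear.Build K A A _ (ad x) (ad_is_linear x).

HB.instance Definition _ (K : comNzRingType) (V : lmodType K) (T : {linear V -> V})
    (p : {poly K}) :=
  GRing.isLinear.Build K V V _ (polyact T p) (polyact_linear T p).

(** Left multiplication by [a] and right multiplication by [b] commute, so each term of the expanded
    power has at least [m] factors [a] left of [c] or [m] factors [b] right of it. *)
Lemma iter_twosided_eq0 (A : pzRingType) (a b c : A) m :
    a ^+ m * c = 0 -> c * b ^+ m = 0 ->
  iter (m + m) (fun u => a * u - u * b) c = 0.
Proof.
move=> ac cb; set T := fun u => _.
suff H k i j : (m + m <= i + j + k)%N -> a ^+ i * iter k T c * b ^+ j = 0.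
  by have := H (m + m)%N 0 0 (leqnn _); rewrite mul1r mulr1.
elim: k i j => [|k IHk] i j.
  rewrite addn0 /= => le_ij; have [le_mi | lt_im] := leqP m i.
    by rewrite -(subnK le_mi) exprD -(mulrA (a ^+ _)) ac mulr0 mul0r.
  have le_mj : (m <= j)%N.
    by rewrite leqNgt; apply: contraL le_ij => lt_jm; rewrite -ltnNge -addnS leq_add // ltnW.
  by rewrite -(subnKC le_mj) exprD mulrA -(mulrA (a ^+ _)) cb mulr0 mul0r.
move=> le_ijk; set u := iter k T c.
have -> : a ^+ i * iter k.+1 T c * b ^+ j
    = a ^+ i.+1 * u * b ^+ j - a ^+ i * u * b ^+ j.+1.
  by rewrite iterS {1}/T mulrBr mulrBl exprSr exprS !mulrA.
by rewrite !IHk ?subr0 // ?addSn ?addnS ?addSn // -addnS.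
Qed.

Section SpectralIdempotents.
Variables (K : fieldType) (n : nat) (X : 'M[K]_n.+1) (s : seq K) (m : nat).
Hypotheses (us : uniq s) (Xs : horner_mx X (\prod_(c <- s) ('X - c%:P) ^+ m) = 0).

Let e d := sval (polynomial_crt (fun c => (c == d)%:R) m us).
Let eP c d : c \in s -> ('X - c%:P) ^+ m %| e d - ((c == d)%:R)%:P.
Proof. by move=> cs; rewrite /e; case: polynomial_crt => p /= ->. Qed.
Let e_neq c d : c \in s -> c != d -> ('X - c%:P) ^+ m %| e d.
Proof. by move=> cs cd; by have := eP d cs; rewrite (negPf cd) polyC0 subr0. Qed.

Let X0 p : {in s, forall c, ('X - c%:P) ^+ m %| p} -> horner_mx X p = 0.
Proof.
move=> Hp; have /dvdpP[q ->] := prod_XsubC_exp_dvdp us Hp.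
by rewrite rmorphM /= Xs mulr0.
Qed.

Let XsubE d k : (X - d%:A) ^+ k = horner_mx X (('X - d%:P) ^+ k).
Proof. by rewrite rmorphXn rmorphB /= horner_mx_X horner_mx_C scalemx1. Qed.

(** For [d] in [s], the projector onto the generalized eigenspace of [X] at [d], as a polynomial in
    [X]. *)
Definition spectral_idem d := horner_mx X (e d).
Local Notation E := spectral_idem.

Lemma spectral_idem_orth d d' : d != d' -> E d * E d' = 0.
Proof.
move=> dd'; rewrite -rmorphM; apply: X0 => c cs; have [cd | cd] := eqVneq c d.
  by apply/dvdp_mull/e_neq; rewrite // cd.
exact/dvdp_mulr/e_neq.
Qed.

Lemma spectral_idem_sum : \sum_(d <- s) E d = 1.
Proof.
rewrite -rmorph_sum /=; apply/eqP; rewrite -subr_eq0 -[1](rmorph1 (horner_mx X)).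
rewrite -rmorphB; apply/eqP/X0 => c cs; rewrite (bigD1_seq c) //= addrAC.
rewrite dvdp_add //; first by have := eP c cs; rewrite eqxx.
rewrite big_seq_cond; apply: (big_ind (fun p => _ %| p)) => [||d /andP[_ dc]].
- exact: dvdp0.
- exact: dvdp_add.
- by apply: e_neq; rewrite // eq_sym.
Qed.

Lemma spectral_idemK d : d \in s -> E d * E d = E d.
Proof.
move=> ds; rewrite -[RHS]mulr1 -spectral_idem_sum (bigD1_seq d) //= mulrDr.
rewrite mulr_sumr big1 ?addr0 // => c cd; rewrite spectral_idem_orth //.
by rewrite eq_sym.
Qed.

Lemma spectral_idem_nil d : (X - d%:A) ^+ m * E d = 0.
Proof.
rewrite XsubE -rmorphM; apply: X0 => c cs; have [-> | cd] := eqVneq c d.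
  exact: dvdp_mulr.
exact/dvdp_mull/e_neq.
Qed.

Lemma spectral_idem_comm d : E d * X = X * E d.
Proof. by apply/comm_horner_mx. Qed.

(* On [E a * Y * E b] the operator [ad X] has the only eigenvalue [a - b]. *)
Lemma polyact_ad_spectral (v : K -> K) p a b Y :
    ('X - (a - b)%:P) ^+ (m + m) %| p - (v (a - b))%:P ->
  polyact (ad X) p (E a * Y * E b) = v (a - b) *: (E a * Y * E b).
Proof.
case/dvdpP=> q /eqP; rewrite subr_eq addrC => /eqP->.
rewrite polyactD polyactC polyactM_XsubC_exp.
rewrite (eq_iter (_ : _ =1 (fun u => (X - a%:A) * u - u * (X - b%:A)))); last first.
  move=> u; rewrite /= /ad mulrBl mulrBr -scalerAl -scalerAr mul1r mulr1.
  by rewrite scalerBl !opprB addrACA [RHS]addrACA [- _ + _]addrC.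
rewrite iter_twosided_eq0 ?linear0 ?addr0 //.
  by rewrite !mulrA spectral_idem_nil !mul0r.
by rewrite -(mulrA (E a * Y)) XsubE [E b * _]comm_horner_mx2 -XsubE spectral_idem_nil mulr0.
Qed.

(** Both sides act on the block [E a * Y * E b] by the scalar [phi a - phi b]. So [ad] of the
    diagonalizable matrix with eigenvalues [phi d] is a polynomial in [ad X]. *)
Lemma polyact_ad_semisimple (phi v : K -> K) p :
    {in s &, forall a b, v (a - b) = phi a - phi b} ->
    {in s &, forall a b, ('X - (a - b)%:P) ^+ (m + m) %| p - (v (a - b))%:P} ->
  forall Y, polyact (ad X) p Y = ad (\sum_(d <- s) phi d *: E d) Y.
Proof.
move=> vphi Hp Y; set z := \sum_(d <- s) _.
have zE d : d \in s -> z * E d = phi d *: E d /\ E d * z = phi d *: E d.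
  move=> ds; rewrite /z mulr_suml mulr_sumr !(bigD1_seq d) //=.
  rewrite -scalerAl -scalerAr spectral_idemK // !big1 ?addr0 // => c cd.
    by rewrite -scalerAr spectral_idem_orth ?scaler0 // eq_sym.
  by rewrite -scalerAl spectral_idem_orth ?scaler0.
have -> : Y = \sum_(a <- s) \sum_(b <- s) E a * Y * E b.
  under eq_bigr => a _ do rewrite -mulr_sumr spectral_idem_sum mulr1.
  by rewrite -mulr_suml spectral_idem_sum mul1r.
rewrite !linear_sum !big_seq; apply: eq_bigr => a sa.
rewrite !linear_sum !big_seq; apply: eq_bigr => b sb.
apply: etrans (polyact_ad_spectral _ (Hp a b sa sb)) _; rewrite vphi // scalerBl.
have [za _] := zE a sa; have [_ zb] := zE b sb.
rewrite -[RHS]/(ad z (E a * Y * E b)) /ad.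
by rewrite !mulrA za -(mulrA (E a * Y)) zb -!scalerAl -!scalerAr.
Qed.
End SpectralIdempotents.

(** Let [z] act as [phi d] on the generalized eigenspace at [d], for an integer functional [phi] on
    the eigenvalues. As [ad z] is a polynomial in [ad X], the hypotheses give [\tr (X * z) = 0], an
    integer relation between eigenvalues [d] with coefficients [phi d] times multiplicity. Applying
    [phi] gives a vanishing sum of multiplicities times squares, so an eigenvalue with [phi d != 0]
    has multiplicity 0. *)
Lemma cartan_nilpotent_split (K : fieldType) n (X : 'M[K]_n.+1) (s0 : seq K)
    k (A B : 'I_k -> 'M[K]_n.+1) :
    [pchar K] =i pred0 ->
    char_poly X %= \prod_(z <- s0) ('X - z%:P) ->
    X = \sum_i ad (A i) (B i) ->
    (forall i j, \tr (A i * iter j (ad X) (B i)) = 0) ->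
  exists m, X ^+ m = 0.
Proof.
move=> K0 Xs0 DX trX; pose s := undup s0; pose m := size s0; exists m.
have us : uniq s := undup_uniq _.
have Xs : horner_mx X (\prod_(c <- s) ('X - c%:P) ^+ m) = 0.
  have : char_poly X %| \prod_(c <- s) ('X - c%:P) ^+ m.
    rewrite (eqp_dvdl _ Xs0) prodrXl /m.
    have : all [pred z | 'X - z%:P %| \prod_(c <- s) ('X - c%:P)] s0.
      apply/allP => z zs0 /=; rewrite (big_rem z) ?mem_undup //=; exact: dvdp_mulr.
    set Q := \prod_(c <- s) _; elim: (s0) => [|z r IHr] /=; first by rewrite big_nil dvd1p.
    by case/andP=> zQ /IHr rQ; rewrite big_cons exprS dvdp_mul.
  by case/dvdpP=> q ->; rewrite rmorphM /= Cayley_Hamilton mulr0.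
pose E := spectral_idem X m us.
have E0 x : x \in s -> x != 0 -> E x = 0.
  move=> xs x0; have [phi phix Hphi] := integer_functional K0 us xs x0.
  pose ps := [seq (a, b) | a <- s, b <- s].
  (* The value must depend on the difference alone, so a representative pair is picked; [vphi] shows
     that the pick is harmless, [c - d = a - b] being an integer relation kept by [phi]. *)
  pose v d := let p := nth (0, 0) ps (find (fun p => p.1 - p.2 == d) ps) in
    ((phi p.1)%:~R - (phi p.2)%:~R) : K.
  pose phiK d := (phi d)%:~R : K.
  have vphi : {in s &, forall a b, v (a - b) = phiK a - phiK b}.
    move=> a b sa sb; rewrite /v; set P := fun p => _.
    have hP : has P ps.
      by apply/hasP; exists (a, b); [apply/allpairsP; exists (a, b) | rewrite /P].
    have := nth_find (0, 0) hP; have := mem_nth (0, 0) (_ : (find P ps < size ps)%N).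
    rewrite -has_find => /(_ hP); set p := nth _ _ _.
    case/allpairsP=> -[c d] /= [sc sd ->] {p} /= /eqP cdab.
    have Dl (R : pzRingType) (g : K -> R) x1 : x1 \in s -> \sum_(y <- s) (y == x1)%:R * g y = g x1.
      move=> sx1; rewrite (bigD1_seq x1) //= eqxx mul1r big1 ?addr0 // => y /negPf->.
      by rewrite mul0r.
    have Dl4 (R : pzRingType) (g : K -> R) :
        \sum_(y <- s) ((y == c)%:R - (y == d)%:R - ((y == a)%:R - (y == b)%:R)) * g y
        = g c - g d - (g a - g b).
      by under eq_bigr => y _ do rewrite !mulrBl; rewrite !sumrB !Dl.
    have := Hphi (fun y => (y == c)%:R - (y == d)%:R - ((y == a)%:R - (y == b)%:R)).
    rewrite (Dl4 int phi) (_ : \sum_(y <- s) _ = 0).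
      by move=> /(_ erefl) /eqP; rewrite subr_eq0 /phiK -!rmorphB => /eqP->.
    rewrite -[RHS](subrr (a - b)) -[X in X - _]cdab -(Dl4 K id).
    by apply: eq_bigr => y _; rewrite !rmorphB /= !rmorph_nat.
  have [p Hp] := polynomial_crt v (m + m) (undup_uniq [seq a - b | a <- s, b <- s]).
  have {}Hp : {in s &, forall a b, ('X - (a - b)%:P) ^+ (m + m) %| p - (v (a - b))%:P}.
    by move=> a b sa sb; apply: Hp; rewrite mem_undup; apply/allpairsP; exists (a, b).
  have adz := polyact_ad_semisimple us Xs vphi Hp.
  have trad (x1 y w : 'M[K]_n.+1) : \tr (ad x1 y * w) = - \tr (x1 * ad w y).
    rewrite /ad mulrBl mulrBr !linearB /= opprB -[y * x1 * w]mulrA.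
    by rewrite [\tr (y * _)]mxtrace_mulC !mulrA.
  have tr_z : \tr (X * \sum_(d <- s) phiK d *: E d) = 0.
    set z := \sum_(d <- s) _ in adz *.
    have : \sum_i \tr (A i * polyact (ad X) p (B i)) = 0.
      rewrite big1 // => i _; rewrite /polyact mulr_sumr linear_sum big1 // => j _.
      by rewrite -scalerAr linearZ /= trX mulr0.
    under eq_bigr => i _ do rewrite adz.
    move=> H; rewrite DX mulr_suml linear_sum -[RHS]oppr0 -[in RHS]H -sumrN.
    by apply: eq_bigr => i _; apply: trad.
  have trE : \sum_(d <- s) (phi d * (\rank (E d))%:R)%:~R * d = 0 :> K.
    rewrite -[RHS]tr_z mulr_sumr linear_sum !big_seq; apply: eq_bigr => d sd /=.
    rewrite -scalerAr linearZ /= rmorphM /= rmorph_nat -mulrA; congr (_ * _).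
    rewrite -mxtrace_idempotent; last exact: (spectral_idemK us Xs).
    have nilE : ((X - d%:A) * E d) ^+ m.+1 = 0.
      rewrite exprMn_comm.
        by rewrite exprS [E d ^+ _]exprS mulrA -(mulrA (X - _)) spectral_idem_nil // mulr0 mul0r.
      by rewrite /GRing.comm mulrBl mulrBr spectral_idem_comm -scalerAl -scalerAr mul1r mulr1.
    have : \tr ((X - d%:A) * E d) = 0.
      by apply: (@mxtrace_nilpotent _ _ _ m.+1); rewrite -[RHS]nilE -iter_mulr_1.
    rewrite mulrBl linearB /= -scalerAl mul1r linearZ /= => /eqP.
    by rewrite subr_eq0 mulrC => /eqP->.
  have := Hphi _ trE; under eq_bigr => d _ do rewrite mulrAC.
  move/eqP; rewrite psumr_eq0; last first.
    by move=> d _; rewrite mulr_ge0 ?sqr_ge0 // ler0n.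
  move/allP/(_ x xs); rewrite mulf_eq0 mulf_eq0 (negPf phix) /= pnatr_eq0 mxrank_eq0.
  by move/eqP.
rewrite -[LHS]mulr1 -(spectral_idem_sum us Xs) mulr_sumr big_seq big1 // => d sd.
have [-> | d0] := eqVneq d 0; last by rewrite -/(E d) E0 ?mulr0.
by have := spectral_idem_nil us Xs 0; rewrite scale0r subr0.
Qed.

(** Extension to a splitting field of the characteristic polynomial preserves the trace conditions
    and reflects nilpotency. *)
Lemma cartan_nilpotent (F : fieldType) n (X : 'M[F]_n.+1)
    k (A B : 'I_k -> 'M[F]_n.+1) :
    [pchar F] =i pred0 ->
    X = \sum_i ad (A i) (B i) ->
    (forall i j, \tr (A i * iter j (ad X) (B i)) = 0) ->
  exists m, X ^+ m = 0.
Proof.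
move=> F0 DX trX.
have [K [iota [s Ds]]] := splitting_field_exists (monic_neq0 (char_poly_monic X)).
have ad_iota Y Z : map_mx iota (ad Y Z) = ad (map_mx iota Y) (map_mx iota Z).
  by rewrite /ad rmorphB !rmorphM.
rewrite map_char_poly in Ds.
have [||| m Xm] := cartan_nilpotent_split (A := map_mx iota \o A) (B := map_mx iota \o B) _ Ds.
- by move=> p; rewrite (fmorph_pchar iota).
- by rewrite {1}DX rmorph_sum; apply: eq_bigr => i _; apply: ad_iota.
- move=> i j /=.
  have -> : iter j (ad (map_mx iota X)) (map_mx iota (B i)) = map_mx iota (iter j (ad X) (B i)).
    by elim: j => //= j ->; rewrite ad_iota.
  by rewrite -rmorphM /= trace_map_mx trX rmorph0.
by exists m; apply/eqP; rewrite -(map_mx_eq0 iota) rmorphXn /= Xm.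
Qed.

(** * Engel's theorem *)

Section Engel.
Variables (F : fieldType) (A : falgType F).
Implicit Types (g h : {vspace A}) (x y : A).

Lemma adC x y : ad x y = - ad y x.
Proof. by rewrite /ad opprB. Qed.

Lemma adxx x : ad x x = 0.
Proof. exact: subrr. Qed.

Definition ad_closed g := {in g &, forall x y, ad x y \in g}.

Lemma expv_eq0_le h m p : (m <= p)%N -> (h ^+ m = 0)%VS -> (h ^+ p = 0)%VS.
Proof. by move=> le_mp hm; rewrite -(subnK le_mp) expvD hm prodv0. Qed.

(* The span of [h] and [x] generates a nilpotent algebra because [U * h],       *)
(* where [U] is the unital algebra it generates, is a nilpotent two-sided ideal *)
(* modulo which only powers of [x] survive.                                     *)
Lemma expv_add_line h x m k :
    {in h, forall y, ad y x \in h} -> ad_closed h ->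
    (h ^+ m = 0)%VS -> x ^+ k = 0 ->
  exists p, ((h + <[x]>) ^+ p = 0)%VS.
Proof.
move=> hx hh hm xk; set T := (h + <[x]>)%VS; set U := agenv T.
have hU : (h <= U)%VS by apply: subv_trans (sub_agenv _); apply: addvSl.
have xU : (<[x]> <= U)%VS by apply: subv_trans (sub_agenv _); apply: addvSr.
have UhU : (U * h * U <= U * h)%VS.
  apply: agenv_modr.
  rewrite -prodvA prodvDr prodvDr subv_add; apply/andP; split.
    by rewrite prodvA prodvSl // prodv_sub.
  have : (h * <[x]> <= <[x]> * h + h)%VS.
    apply/prodvP => y _ yh /vlineP[c ->].
    rewrite -scalerAr memvZ // -(subrK (x * y) (y * x)) addrC memv_add ?hx //.
    by rewrite memv_mul // memv_line.
  move/(prodvSr U)/subv_trans; apply; rewrite prodvDr subv_add prodvA.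
  by rewrite prodvSl ?subvv // prodv_sub.
have hUh : (h * U <= U * h)%VS.
  by apply: subv_trans UhU; rewrite prodvSl // -{1}(prod1v h) prodvSl // sub1_agenv.
have hjU j : (h ^+ j * U <= U * h ^+ j)%VS.
  elim: j => [|j IHj]; first by rewrite !expv0 prod1v prodv1.
  rewrite {1}expvSl -prodvA; apply: subv_trans (prodvSr _ IHj) _.
  by rewrite expvSl !prodvA prodvSl.
have UhX j : ((U * h) ^+ j <= U * h ^+ j)%VS.
  elim: j => [|j IHj]; first by rewrite !expv0 prodv1 sub1_agenv.
  rewrite expvSr; apply: subv_trans (prodvSl _ IHj) _.
  rewrite prodvA -(prodvA U); apply: subv_trans (prodvSl _ (prodvSr _ (hjU j))) _.
  by rewrite prodvA agenvM expvSr prodvA.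
have TX j : (T ^+ j <= <[x]> ^+ j + U * h)%VS.
  elim: j => [|j IHj]; first by rewrite !expv0 addvSl.
  rewrite expvSr; apply: subv_trans (prodvSl _ IHj) _.
  rewrite prodvDl subv_add; apply/andP; split; last first.
    apply: subv_trans (addvSr _ _); apply: subv_trans UhU.
    by rewrite prodvSr // sub_agenv.
  rewrite prodvDr addvC addvS ?expvSr // prodvSl //.
  by apply: subv_trans (subX_agenv _ j); rewrite expvS // addvSr.
exists (k * m)%N; rewrite expvM; apply/eqP; rewrite -subv0.
apply: subv_trans (expvS m (TX k)) _.
by rewrite expv_line xk add0v (subv_trans (UhX m)) // hm prodv0.
Qed.

(** An [ad]-closed [h] in [g] with a vanishing associative power is enlarged by a line that it
    normalizes until it is [g]; [n] bounds its dimension from below. *)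
Lemma engel g : ad_closed g -> {in g, forall x, exists k, x ^+ k = 0} ->
  exists p, (g ^+ p = 0)%VS.
Proof.
move=> gg gnil.
suff H n : exists h, [/\ (h <= g)%VS, ad_closed h, exists p, (h ^+ p = 0)%VS
    & (n <= \dim h)%N \/ h = g].
  have [h [hg _ [p hp] [lt|<-]]] := H (\dim g).+1; last by exists p.
  by rewrite leqNgt ltnS dimvS in lt.
elim: n => [|n [h [hg hh [p hp] [le_nh | hEg]]]].
- exists 0%VS; split; rewrite ?sub0v //; last by left.
    by move=> x y; rewrite !memv0 => /eqP-> /eqP->; rewrite /ad mulr0 subrr.
  by exists 1%N; rewrite expv1.
- have [gh | ngh] := boolP (g <= h)%VS.
    exists h; split=> //; first by exists p.
    by right; apply/eqP; rewrite eqEsubv hg.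
  (* Iterating [ad h] on an element outside [h] must eventually enter [h]. *)
  have [x [xg nxh xN]] : exists x, [/\ x \in g, x \notin h & {in h, forall y, ad y x \in h}].
    apply: NNPP => nex.
    (* [S k] is spanned by products of an element of [g] with [k] factors from [h] on either side;
       for [k = p + p] one side has at least [p] of them. Without a normalizing [x], brackets with
       [h] would leave elements outside [h] in every [S k]. *)
    pose S k := iter k (fun V => h * V + V * h)%VS g.
    have S0 k i j : (p + p <= i + j + k)%N -> (h ^+ i * S k * h ^+ j = 0)%VS.
      elim: k i j => [|k IHk] i j le_p.
        rewrite addn0 in le_p; have [le_pi | lt_ip] := leqP p i.
          by rewrite (expv_eq0_le le_pi hp) !prod0v.
        rewrite [(h ^+ j)%VS](@expv_eq0_le _ p) ?prodv0 //.
        by rewrite leqNgt; apply: contraL le_p => lt_jp; rewrite -ltnNge -addnS leq_add // ltnW.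
      rewrite /= prodvDr prodvDl prodvA -expvSr -!prodvA -expvSl !prodvA.
      by rewrite !IHk ?addv0 //; move: le_p; rewrite !addnS ?addSn.
    have H k : exists x, [/\ x \in g, x \notin h & x \in S k].
      elim: k => [|k [x [xg nxh xS]]].
        by have /subvPn[x xg nxh] := ngh; exists x.
      apply: NNPP => nx; apply: nex; exists x; split=> // y yh.
      apply/negPn/negP => nyx; apply: nx; exists (ad y x).
      split=> //; first by apply: gg => //; apply: subvP yh.
      by rewrite /ad -mulrN memv_add ?memv_mul // memvN.
    have [x [xg nxh xS]] := H (p + p)%N.
    have := S0 (p + p)%N 0 0 (leqnn _); rewrite expv0 prod1v prodv1 => S_0.
    by rewrite S_0 memv0 in xS; rewrite (eqP xS) mem0v in nxh.
  have [k xk] := gnil x xg.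
  exists (h + <[x]>)%VS; split.
  + by rewrite subv_add hg.
  + have xNr y : y \in h -> ad x y \in h by move=> yh; rewrite adC memvN xN.
    move=> _ _ /memv_addP[a ah [_ /vlineP[c ->] ->]] /memv_addP[b bh [_ /vlineP[d ->] ->]].
    apply: (subvP (addvSl h <[x]>)); rewrite linearD linearZ /= rpredD ?rpredZ //.
      rewrite adC memvN linearD linearZ /= rpredD ?rpredZ //; [exact: hh | exact: xN].
    by rewrite adC memvN linearD linearZ /= adxx scaler0 addr0 xNr.
  + exact: expv_add_line hh hp xk.
  + left; apply: leq_ltn_trans le_nh _; rewrite ltnNge.
    apply: contra nxh => le_dim; rewrite memvE (subv_trans (addvSr h _)) //.
    by have := eqEdim h (h + <[x]>); rewrite le_dim addvSl => /eqP {2}->.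
- by exists h; split=> //; [exists p | right].
Qed.
End Engel.

(** * Trace forms on semi-simple Leibniz algebras *)

(** A subspace inside [P] is enlarged, by excluded middle, until the dimension stops it. *)
Lemma subspace_of_pred (F : fieldType) (V : vectType F) (P : V -> Prop) :
    P 0 -> (forall a x y, P x -> P y -> P (a *: x + y)) ->
  exists U : {vspace V}, forall x, x \in U <-> P x.
Proof.
move=> P0 PD.
suff H n : exists U : {vspace V}, (forall x, x \in U -> P x) /\
    ((n <= \dim U)%N \/ forall x, P x -> x \in U).
  have [U [UP [lt|PU]]] := H (\dim {:V}).+1; last by exists U; split; auto.
  by rewrite leqNgt ltnS dimvS ?subvf in lt.
elim: n => [|n [U [UP [le_nU|PU]]]]; last by exists U; auto.
  by exists 0%VS; split=> [x|]; [rewrite memv0 => /eqP-> | left].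
case: (classic (forall x, P x -> x \in U)) => [PU | /not_all_ex_not[x]].
  by exists U; auto.
move/(imply_to_and (P x))=> [Px /negP nUx]; exists (U + <[x]>)%VS; split.
  by move=> _ /memv_addP[u uU [_ /vlineP[a ->] ->]]; rewrite addrC; auto.
left; apply: leq_ltn_trans le_nU _; rewrite ltnNge; apply: contra nUx => le_dim.
rewrite memvE (subv_trans (addvSr U _)) //.
by have := eqEdim U (U + <[x]>); rewrite le_dim addvSl => /eqP {2}->.
Qed.

Section Coordinates.
Variables (F : fieldType) (V : vectType F).

Definition vcoord (v : V) : 'rV[F]_(\dim {:V}) := \row_i coord (vbasis {:V}) i v.
Definition vcombine (u : 'rV[F]_(\dim {:V})) : V := \sum_i u 0 i *: (vbasis {:V})`_i.

Fact vcoord_linear : linear vcoord.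
Proof. by move=> a u v; apply/rowP=> i; rewrite !mxE linearP. Qed.
Fact vcombine_linear : linear vcombine.
Proof.
move=> a u v; rewrite /vcombine scaler_sumr -big_split; apply: eq_bigr => i _ /=.
by rewrite !mxE scalerDl scalerA.
Qed.
HB.instance Definition _ := GRing.isLinear.Build F V _ _ vcoord vcoord_linear.
HB.instance Definition _ := GRing.isLinear.Build F _ V _ vcombine vcombine_linear.

Lemma vcoordK : cancel vcoord vcombine.
Proof.
by move=> v; rewrite [RHS](coord_vbasis (memvf v)); apply: eq_bigr => i _; rewrite mxE.
Qed.

Lemma vcombineK : cancel vcombine vcoord.
Proof.
move=> u; apply/rowP=> i; rewrite mxE coord_sum_free //.
by have /andP[] := vbasisP {:V}.
Qed.
End Coordinates.

Section Bilinear.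
Variables (F : fieldType) (A B C : lmodType F) (h : A -> B -> C).
Hypothesis hP : bilinear_map h.

(* The proof argument makes the linear structures below inferable. *)
Definition bil_l of bilinear_map h := fun y x => h x y.
Definition bil_r of bilinear_map h := fun x y => h x y.
Fact bil_l_linear y : linear (bil_l hP y). Proof. by move=> a u v; apply: hP.1. Qed.
Fact bil_r_linear x : linear (bil_r hP x). Proof. by move=> a u v; apply: hP.2. Qed.
HB.instance Definition _ y := GRing.isLinear.Build F A C _ (bil_l hP y) (bil_l_linear y).
HB.instance Definition _ x := GRing.isLinear.Build F B C _ (bil_r hP x) (bil_r_linear x).

Lemma bil0r x : h x 0 = 0. Proof. exact: (linear0 (bil_r hP x)). Qed.
Lemma bilZl a x y : h (a *: x) y = a *: h x y.
Proof. exact: (linearZZ (bil_l hP y)). Qed.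
Lemma bilZr a x y : h x (a *: y) = a *: h x y.
Proof. exact: (linearZZ (bil_r hP x)). Qed.
Lemma bilDl x1 x2 y : h (x1 + x2) y = h x1 y + h x2 y.
Proof. exact: (linearD (bil_l hP y)). Qed.
Lemma bilDr x y1 y2 : h x (y1 + y2) = h x y1 + h x y2.
Proof. exact: (linearD (bil_r hP x)). Qed.
Lemma bilBr x y1 y2 : h x (y1 - y2) = h x y1 - h x y2.
Proof. exact: (linearB (bil_r hP x)). Qed.
Lemma bil_suml I (r : seq I) P f y :
  h (\sum_(i <- r | P i) f i) y = \sum_(i <- r | P i) h (f i) y.
Proof. exact: (linear_sum (bil_l hP y)). Qed.
Lemma bil_sumr I (r : seq I) P f x :
  h x (\sum_(i <- r | P i) f i) = \sum_(i <- r | P i) h x (f i).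
Proof. exact: (linear_sum (bil_r hP x)). Qed.
End Bilinear.

Section Leibniz.
Variables (F : fieldType) (L : vectType F) (mul : L -> L -> L).
Hypotheses (F0 : [pchar F] =i pred0) (mulP : bilinear_map mul) (mulL : left_leibniz mul).
Implicit Types (U V W I J : {vspace L}) (x y : L).

Definition product_space U V :=
  <<[seq mul p.1 p.2 | p <- [seq (u, v) | u <- vbasis U, v <- vbasis V]]>>%VS.

Lemma product_spaceP U V : is_product_space mul U V (product_space U V).
Proof.
split=> [u v uU vV | W HW]; last first.
  apply/span_subvP => _ /mapP[_ /allpairsP[[u v] [/= uU vV ->]] ->] /=.
  by apply: HW; apply: vbasis_mem.
rewrite (coord_vbasis uU) (coord_vbasis vV) (bil_suml mulP) rpred_sum // => i _.
rewrite (bilZl mulP) rpredZ // (bil_sumr mulP) rpred_sum // => j _.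
rewrite (bilZr mulP) rpredZ // memv_span //; apply/mapP.
exists ((vbasis U)`_i, (vbasis V)`_j) => //.
by apply/allpairsP; exists ((vbasis U)`_i, (vbasis V)`_j); rewrite !mem_nth ?size_tuple.
Qed.

Lemma mem_product_space U V x : x \in product_space U V ->
  exists k (a b : 'I_k -> L), [/\ forall i, a i \in U, forall i, b i \in V
    & x = \sum_i mul (a i) (b i)].
Proof.
set ps := [seq (u, v) | u <- vbasis U, v <- vbasis V].
have psP p : p \in ps -> p.1 \in U /\ p.2 \in V.
  by case/allpairsP=> -[u v] [/= /vbasis_mem uU /vbasis_mem vV ->].
rewrite /product_space -/ps => xps.
pose X := in_tuple [seq mul p.1 p.2 | p <- ps].
have sX (i : 'I_(size [seq mul p.1 p.2 | p <- ps])) : (i < size ps)%N.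
  by case: i => i /=; rewrite size_map.
exists _, (fun i => coord X i x *: (nth (0, 0) ps i).1), (fun i => (nth (0, 0) ps i).2).
split=> [i|i|].
- by rewrite rpredZ // (psP _ _).1 // mem_nth.
- by rewrite (psP _ _).2 // mem_nth.
rewrite {1}(coord_span (X := X) xps); apply: eq_bigr => i _.
by rewrite (bilZl mulP) (nth_map (0, 0)).
Qed.

Lemma product_spaceS U U' V V' : (U <= U')%VS -> (V <= V')%VS ->
  (product_space U V <= product_space U' V')%VS.
Proof.
move=> sU sV; apply: (product_spaceP U V).2 => u v uU vV.
by apply: (product_spaceP U' V').1; apply: subvP; eassumption.
Qed.

Definition mul_closed I := {in I &, forall x y, mul x y \in I}.
Definition derived_space k I := iter k (fun U => product_space U U) I.

Lemma derived_spaceS k I J : (I <= J)%VS -> (derived_space k I <= derived_space k J)%VS.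
Proof. by move=> sIJ; elim: k => //= k IHk; apply: product_spaceS. Qed.

Lemma derived_space_sub k I : mul_closed I -> (derived_space k I <= I)%VS.
Proof.
move=> cI; elim: k => [|k IHk] /=; first exact: subvv.
apply: (product_spaceP _ _).2 => u v uD vD.
by apply: cI; apply: subvP IHk _ _.
Qed.

Lemma derived_space_solvable k I : derived_space k I = 0%VS -> is_solvable mul I.
Proof.
move=> D0; exists (fun j => derived_space j I), k; split=> //; split=> // j.
exact: product_spaceP.
Qed.

Lemma ideal_mul_closed I : is_ideal mul I -> mul_closed I.
Proof. by move=> iI x y _ yI; case: (iI x y yI). Qed.

Section Rep.
Variables (n : nat) (rho : {linear L -> 'M[F]_n.+1}).

(* The row-vector convention makes [rho] an anti-homomorphism. *)
Definition mx_rep := forall x y, rho (mul x y) = rho y * rho x - rho x * rho y.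
Hypothesis rhoP : mx_rep.
Local Notation B x y := (\tr (rho x * rho y)).

Lemma trace_formC x y : B x y = B y x.
Proof. exact: mxtrace_mulC. Qed.

Lemma trace_form_inv x y z : B (mul x y) z = - B y (mul x z).
Proof.
rewrite /= !rhoP mulrBl mulrBr !linearB /= opprB !mulrA; congr (_ - _).
by rewrite -[rho x * _ * _]mulrA mxtrace_mulC.
Qed.

(** Elements of the derived space [D1] are sums of products, so Cartan's criterion makes their
    images nilpotent. By Engel the image [g] of [D1] has a vanishing power, and each further derived
    space maps into the next power of [g]. *)
Lemma cartan_solvable I : mul_closed I -> {in I &, forall x y, B x y = 0} ->
  exists k, forall x, x \in derived_space k I -> rho x = 0.
Proof.
move=> cI B0; pose D1 := product_space I I; pose g := (linfun rho @: D1)%VS.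
have sD1 : (D1 <= I)%VS by apply: (product_spaceP I I).2.
have gP x : x \in D1 -> rho x \in g by move=> xD; rewrite -[rho x]lfunE memv_img.
have adr x y : ad (rho x) (rho y) = rho (- mul x y).
  by rewrite linearN rhoP opprB.
have cg : ad_closed g.
  move=> _ _ /memv_imgP[x xD ->] /memv_imgP[y yD ->]; rewrite !lfunE adr gP // memvN.
  by apply: (product_spaceP I I).1; apply: subvP sD1 _ _.
have [p gp] : exists p, (g ^+ p = 0)%VS.
  apply: engel cg _ => _ /memv_imgP[x xD ->]; rewrite lfunE.
  have [k [a [b [aI bI Dx]]]] := mem_product_space xD.
  (* The two families are exchanged because [rho] reverses products. *)
  apply: (cartan_nilpotent (A := rho \o b) (B := rho \o a) F0).
    by rewrite /= {1}Dx linear_sum; apply: eq_bigr => i _; rewrite /= rhoP.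
  move=> i j /=.
  suff [z zI ->] : exists2 z, z \in I & iter j (ad (rho x)) (rho (a i)) = rho z by apply: B0.
  elim: j => [|j [z zI /= ->]]; first by exists (a i).
  by rewrite adr; exists (- mul x z); rewrite // memvN cI // (subvP sD1).
exists p.+1 => x xD.
suff {x xD} H k x : x \in derived_space k.+1 I -> rho x \in (g ^+ k.+1)%VS.
  have := H p x xD; rewrite expvSl gp prodv0 memv0; exact: eqP.
elim: k x => [|k IHk] x; first by rewrite expv1; apply: gP.
have sDD : (derived_space k.+1 I <= D1)%VS.
  rewrite /derived_space iterSr; apply: derived_space_sub => u v uD vD.
  by apply: (product_spaceP I I).1; apply: subvP sD1 _ _.
rewrite -[rho x]lfunE memv_preim; apply: subvP.
apply: (product_spaceP _ _).2 => u v uD vD; rewrite -memv_preim lfunE /= rhoP.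
rewrite rpredB //; first by rewrite expvSl memv_mul ?gP ?IHk // (subvP sDD).
by rewrite expvSr memv_mul ?gP ?IHk // (subvP sDD).
Qed.


Let l := \dim {:L}.
Let e (i : 'I_l) := (vbasis {:L})`_i.
Definition trace_gram : 'M[F]_l := \matrix_(i, j) B (e i) (e j).
Local Notation G := trace_gram.

Lemma trace_gram_sym : G^T = G.
Proof. by apply/matrixP=> i j; rewrite !mxE trace_formC. Qed.

Lemma trace_gramE (u v : 'rV[F]_l) : B (vcombine u) (vcombine v) = (u *m G *m v^T) 0 0.
Proof.
rewrite mxE /vcombine !linear_sum mulr_sumr linear_sum; apply: eq_bigr => j _ /=.
rewrite mulr_suml linear_sum !mxE mulr_suml; apply: eq_bigr => i _ /=.
rewrite !linearZ /= -scalerAl -scalerAr !linearZ /= !mxE.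
by rewrite [v 0 j * _]mulrC mulrA.
Qed.

Lemma trace_gram_ker (u : 'rV[F]_l) : (forall y, B (vcombine u) y = 0) <-> u *m G = 0.
Proof.
split=> [uB | uG y]; last by rewrite -(vcoordK y) trace_gramE uG mul0mx mxE.
apply/rowP=> j; rewrite [RHS]mxE -[RHS](uB (e j)) mxE /= /vcombine linear_sum mulr_suml linear_sum.
by apply: eq_bigr => i _; rewrite mxE linearZ /= -scalerAl linearZ.
Qed.

Let T x : 'M[F]_l := \matrix_(i, j) coord (vbasis {:L}) j (mul x (e i)).
Let TE x i : mul x (e i) = \sum_j T x i j *: e j.
Proof.
by rewrite [LHS](coord_vbasis (memvf _)); apply: eq_bigr => j _; rewrite mxE.
Qed.

Lemma trace_gram_inv x : T x *m G = - (G *m (T x)^T).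
Proof.
apply/matrixP=> i k; rewrite !mxE.
transitivity (B (mul x (e i)) (e k)).
  rewrite /= TE linear_sum mulr_suml linear_sum; apply: eq_bigr => j _.
  by rewrite linearZ /= -scalerAl linearZ !mxE.
rewrite trace_form_inv TE /= linear_sum mulr_sumr linear_sum; congr (- _).
by apply: eq_bigr => j _; rewrite linearZ /= -scalerAr linearZ !mxE mulrC.
Qed.

Let quad (M : 'M[F]_l) := \sum_i \sum_j M i j *: (rho (e i) * rho (e j)).

Let quad_lin (P Q M : 'M[F]_l) :
  \sum_i \sum_j M i j *: ((\sum_k P i k *: rho (e k)) * (\sum_k Q j k *: rho (e k)))
  = quad (P^T *m M *m Q).
Proof.
pose X i j k k' := (P i k * M i j * Q j k') *: (rho (e k) * rho (e k')).
transitivity (\sum_j \sum_i \sum_k \sum_k' X i j k k').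
  rewrite exchange_big; apply: eq_bigr => j _; apply: eq_bigr => i _.
  rewrite mulr_suml scaler_sumr; apply: eq_bigr => k _.
  rewrite mulr_sumr scaler_sumr; apply: eq_bigr => k' _.
  by rewrite -scalerAl -scalerAr !scalerA [M i j * _]mulrC.
transitivity (\sum_j \sum_k \sum_k' \sum_i X i j k k').
  apply: eq_bigr => j _; rewrite exchange_big; apply: eq_bigr => k _.
  exact: exchange_big.
rewrite exchange_big; apply: eq_bigr => k _; rewrite exchange_big; apply: eq_bigr => k' _.
rewrite mxE scaler_suml; apply: eq_bigr => j _.
by rewrite !mxE mulr_suml scaler_suml; apply: eq_bigr => i _; rewrite !mxE.
Qed.

(* The Casimir element: [pinvmx G] serves as the inverse of the trace form on *)
(* the quotient of [L] by the radical of that form.                           *)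
Lemma casimir_exists :
    (forall x, (forall y, B x y = 0) -> rho x = 0) -> (exists x, rho x != 0) ->
  exists c : 'M[F]_n.+1, [/\ forall x, rho x * c = c * rho x, \tr c != 0
    & exists s : seq (L * L), c = \sum_(p <- s) rho p.1 * rho p.2].
Proof.
move=> radB [x0 rx0].
have [H GHG] : exists H : 'M_l, G *m H *m G = G by exists (pinvmx G); rewrite mulmxKpV.
exists (quad H); split.
- move=> x; apply/eqP; rewrite -subr_eq0; apply/eqP.
  have rT i : rho (mul x (e i)) = \sum_k T x i k *: rho (e k).
    by rewrite TE linear_sum; apply: eq_bigr => k _; rewrite linearZ.
  have r1 i : rho (e i) = \sum_k (1%:M : 'M[F]_l) i k *: rho (e k).
    rewrite (bigD1 i) //= big1 ?addr0 ?mxE ?eqxx ?scale1r // => k ki.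
    by rewrite mxE eq_sym (negPf ki) scale0r.
  set M := (T x)^T *m H + H *m T x.
  (* [M] is the derivative of the tensor [H] along [x]; invariance of the trace form will give
     [G *m M *m G = 0]. *)
  have -> : rho x * quad H - quad H * rho x = - quad M.
    have -> : quad M = \sum_i \sum_j H i j *: (rho (mul x (e i)) * rho (e j))
        + \sum_i \sum_j H i j *: (rho (e i) * rho (mul x (e j))).
      have -> : quad M = quad ((T x)^T *m H *m 1%:M) + quad (1%:M^T *m H *m T x).
        rewrite trmx1 mul1mx mulmx1 /quad -big_split; apply: eq_bigr => i _.
        by rewrite -big_split; apply: eq_bigr => j _; rewrite /= -scalerDl /M mxE.
      rewrite -!quad_lin; congr (_ + _); apply: eq_bigr => i _; apply: eq_bigr => j _.
        by rewrite rT -r1.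
      by rewrite rT -r1.
    rewrite /quad mulr_sumr mulr_suml -big_split -!sumrN -big_split; apply: eq_bigr => i _ /=.
    rewrite mulr_sumr mulr_suml -sumrN -!big_split -sumrN; apply: eq_bigr => j _ /=.
    rewrite -scalerAl -scalerAr -scalerBr -scalerDr -scalerN; congr (_ *: _).
    by rewrite !rhoP mulrBl mulrBr !mulrA opprD !opprB addrA subrK.
  have GTT : G *m (T x)^T = - (T x *m G) by rewrite trace_gram_inv opprK.
  have GMG : G *m M *m G = 0.
    rewrite /M mulmxDr mulmxDl !mulmxA GTT !mulNmx -(mulmxA (T x)) -(mulmxA (T x)) GHG.
    by rewrite -(mulmxA _ (T x)) trace_gram_inv mulmxN mulmxA GHG opprK subrr.
  (* The rows of [1%:M - G *m H] are coordinates of radical elements, which [rho] kills. So [quad M]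
     is unchanged when [M] is multiplied by [G *m H] on the right and its transpose on the left,
     which makes [G *m M *m G] appear. *)
  have rQ i : rho (e i) = \sum_k (G *m H) i k *: rho (e k).
    have uG : row i (1%:M - G *m H) *m G = 0.
      by rewrite -row_mul mulmxBl mul1mx GHG subrr row0.
    have := radB _ ((trace_gram_ker _).2 uG).
    rewrite /vcombine linear_sum /=; under eq_bigr => k _ do rewrite linearZ /= 4!mxE scalerBl.
    rewrite sumrB => /eqP; rewrite subr_eq0 => /eqP; rewrite (bigD1 i) //= eqxx scale1r.
    by rewrite big1 ?addr0 // => k ki; rewrite eq_sym (negPf ki) scale0r.
  suff -> : quad M = quad ((G *m H)^T *m M *m (G *m H)).
    rewrite trmx_mul trace_gram_sym !mulmxA -(mulmxA _ G M) -(mulmxA _ _ G) GMG.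
    by rewrite mulmx0 mul0mx /quad big1 ?oppr0 // => i _; rewrite big1 // => j _; rewrite mxE scale0r.
  by rewrite -quad_lin; apply: eq_bigr => i _; apply: eq_bigr => j _; rewrite -!rQ.
(* The trace is that of the idempotent [H *m G], hence its rank, which vanishes only if [G] does. *)
- have -> : \tr (quad H) = \tr (H *m G).
    rewrite /quad linear_sum; apply: eq_bigr => i _; rewrite linear_sum mxE.
    by apply: eq_bigr => j _; rewrite linearZ -[in RHS]trace_gram_sym !mxE.
  rewrite mxtrace_idempotent; last by rewrite mulmxA -(mulmxA H) -(mulmxA H) GHG.
  apply: contraNneq rx0 => /(pchar0_natr_eq0 F0) /eqP; rewrite mxrank_eq0 => /eqP HG0.
  have G0 : G = 0 by rewrite -GHG -mulmxA HG0 mulmx0.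
  apply/eqP/radB; rewrite -(vcoordK x0); apply/trace_gram_ker.
  by rewrite G0 mulmx0.
- exists [seq (H p.1 p.2 *: e p.1, e p.2) | p <- [seq (i, j) | i <- enum 'I_l, j <- enum 'I_l]].
  rewrite big_map big_allpairs big_enum; apply: eq_bigr => i _.
  by rewrite big_enum; apply: eq_bigr => j _; rewrite /= linearZ /= scalerAl.
Qed.

Lemma mx_rep_mulC x y : rho (mul y x) = - rho (mul x y).
Proof. by rewrite !rhoP opprB. Qed.

End Rep.

Section Modules.
Variables (V : vectType F) (act : L -> V -> V).

Definition module_axioms :=
  bilinear_map act /\ forall x y v, act (mul x y) v = act x (act y v) - act y (act x v).

Lemma module_matrix : module_axioms -> (exists v : V, v != 0) ->
  exists n (rho : {linear L -> 'M[F]_n.+1}) (f : {linear V -> 'rV[F]_n.+1})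
    (g : {linear 'rV[F]_n.+1 -> V}),
  [/\ cancel f g, cancel g f, mx_rep rho & forall x v, f (act x v) = f v *m rho x].
Proof.
case=> actP actM [v0 nz_v0].
have [n [f [g [fK gK]]]] : exists n (f : {linear V -> 'rV[F]_n}) (g : {linear 'rV[F]_n -> V}),
    cancel f g /\ cancel g f.
  exists (\dim {:V}), (@vcoord F V), (@vcombine F V); split.
    exact: vcoordK.
  exact: vcombineK.
case: n f g fK gK => [|n] f g fK gK.
  by case/eqP: nz_v0; rewrite -[v0]fK (thinmx0 (f v0)) linear0.
pose r x := lin1_mx (f \o (bil_r actP x \o g)).
have rE u x : u *m r x = f (act x (g u)) by rewrite /r mul_rV_lin1.
have r_lin : linear r.
  move=> a x y; apply/row_matrixP => i; rewrite !rowE mulmxDr -scalemxAr !rE.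
  by rewrite (bilDl actP) (bilZl actP) linearD linearZ.
pose rho : {linear L -> 'M[F]_n.+1} := HB.pack r (GRing.isLinear.Build F L _ _ r r_lin).
exists n, rho, f, g; split=> // [x y|x v]; last by rewrite rE fK.
apply/row_matrixP => i; rewrite !rowE mulmxBr !mulmxA !rE !fK actM linearB.
by [].
Qed.
End Modules.

Hypothesis ssL : leib_semisimple mul.

(** A matrix commutes with itself, so [rho] kills all squares; its kernel then contains [Leib(L)]
    and with it every solvable ideal. *)
Lemma solvable_ideal_ker n (rho : {linear L -> 'M[F]_n.+1}) I k : mx_rep rho ->
  is_ideal mul I -> derived_space k I = 0%VS -> {in I, forall x, rho x = 0}.
Proof.
move=> rhoP iI /derived_space_solvable sI x xI; apply/eqP.
have sq : contains_squares mul (lker (linfun rho)).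
  by move=> y; rewrite memv_ker lfunE /= rhoP subrr.
by have := subvP (ssL iI sI sq) x xI; rewrite memv_ker lfunE.
Qed.

Lemma ideal_cap I J : is_ideal mul I -> is_ideal mul J -> is_ideal mul (I :&: J)%VS.
Proof.
move=> iI iJ x y; rewrite memv_cap => /andP[/(iI x)[? ?] /(iJ x)[? ?]].
by rewrite !memv_cap; split; apply/andP.
Qed.

Lemma adjoint_matrix : (exists x : L, x != 0) ->
  exists n (kap : {linear L -> 'M[F]_n.+1}), mx_rep kap /\
    forall x, kap x = 0 -> forall y, mul x y = 0.
Proof.
case/(module_matrix (act := mul)) => [|n [kap [f [g [fK gK kapP fE]]]]].
  by split=> // x y z; rewrite mulL addrK.
exists n, kap; split=> // x kx y; apply: (can_inj fK).
by rewrite fE kx mulmx0 linear0.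
Qed.

(** Cartan's criterion sends some derived space of the radical [R] into the kernel [K] of [rho],
    which need not be solvable. So [R] is cut by [P], the orthogonal of [K] for the trace form of
    the adjoint module: [K :&: P] is solvable, hence so is [R :&: P], and [rho] kills it. As [K + P]
    is everything, [x] can be moved into [P] along [K]. *)
Lemma trace_radical n (rho : {linear L -> 'M[F]_n.+1}) x : mx_rep rho ->
  (forall y, \tr (rho x * rho y) = 0) -> rho x = 0.
Proof.
move=> rhoP xB; have [-> | nz_x] := eqVneq x 0; first by rewrite linear0.
have [m [kap [kapP kap_ker]]] := adjoint_matrix (ex_intro _ x nz_x).
have [K KP] : exists K : {vspace L}, forall z, z \in K <-> rho z = 0.
  apply: subspace_of_pred => [|a y z ry rz]; first by rewrite linear0.
  by rewrite linearP /= ry rz scaler0 addr0.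
have [P PP] : exists P : {vspace L}, forall z,
    z \in P <-> {in K, forall k, \tr (kap z * kap k) = 0}.
  apply: subspace_of_pred => [k _|a y z yP zP k kK]; first by rewrite linear0 mul0r linear0.
  by rewrite linearP /= mulrDl -scalerAl linearP /= yP // zP // mulr0 addr0.
have [R RP] : exists R : {vspace L}, forall z,
    z \in R <-> forall y, \tr (rho z * rho y) = 0.
  apply: subspace_of_pred => [k|a y z yP zP k]; first by rewrite linear0 mul0r linear0.
  by rewrite linearP /= mulrDl -scalerAl linearP /= yP zP mulr0 addr0.
have iK : is_ideal mul K.
  by move=> y z /KP rz; split; apply/KP; rewrite rhoP rz mulr0 mul0r subrr.
have iP : is_ideal mul P.
  move=> y z /PP zP.
  have yzP : {in K, forall k, \tr (kap (mul y z) * kap k) = 0}.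
    by move=> k kK; rewrite trace_form_inv // zP ?oppr0 //; case: (iK y k kK).
  split; apply/PP=> // k kK.
  by rewrite mx_rep_mulC // mulNr linearN /= yzP ?oppr0.
have iR : is_ideal mul R.
  move=> y z /RP zP.
  have yzP k : \tr (rho (mul y z) * rho k) = 0 by rewrite trace_form_inv // zP oppr0.
  split; apply/RP=> // k.
  by rewrite mx_rep_mulC // mulNr linearN /= yzP oppr0.
have iJ := ideal_cap iK iP; have iI := ideal_cap iR iP.
have [j DJ] : exists j, derived_space j (K :&: P) = 0%VS.
  have [|j Dj] := cartan_solvable kapP (ideal_mul_closed iJ).
    by move=> y z /memv_capP[_ /PP yP] /memv_capP[zK _]; apply: yP.
  (* Where [kap] vanishes so do left multiplications, hence one more derived space is 0. *)
  exists j.+1; apply/eqP; rewrite -subv0; apply: (product_spaceP _ _).2 => u v uD _.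
  by rewrite (kap_ker u) ?mem0v // Dj.
have kapJ := solvable_ideal_ker kapP iJ DJ.
have rhoI : {in (R :&: P)%VS, forall z, rho z = 0}.
  have [|k Dk] := cartan_solvable rhoP (ideal_mul_closed iI).
    by move=> y z /memv_capP[/RP yR _] _; apply: yR.
  apply: (solvable_ideal_ker (k := (j + k)%N) rhoP iI); apply/eqP.
  rewrite -subv0 -DJ /derived_space iterD; apply: derived_spaceS.
  apply/subvP=> z zD; apply/memv_capP; split; first exact/KP/Dk.
  by have /memv_capP[] := subvP (derived_space_sub k (ideal_mul_closed iI)) z zD.
suff [k [kK xkP]] : exists k, k \in K /\ x - k \in P.
  have rxk : rho (x - k) = rho x by rewrite linearB (KP k).1 //= subr0.
  by rewrite -rxk rhoI //; apply/memv_capP; split=> //; apply/RP=> y; rewrite rxk.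
(* [K + P = L] for the Killing-orthogonal [P] of [K]: the functionals induced   *)
(* on [K] by [L] and by [K] have the same rank, [K :&: P] being in the radical. *)
pose l := \dim {:L}; pose e (i : 'I_l) := (vbasis {:L})`_i.
pose N : 'M_(l, _) := \matrix_i mxvec (rho (e i)).
have NE u : u *m N = mxvec (rho (vcombine u)).
  rewrite mulmx_sum_row /vcombine !linear_sum; apply: eq_bigr => i _.
  by rewrite rowK !linearZ.
have [A [vecA vecA_onto]] : exists A : 'M_l, (forall u, vcombine (u *m A) \in K) /\
    {in K, forall k, exists u : 'rV_l, k = vcombine (u *m A)}.
  exists (kermx N); split=> [u|k /KP rk].
    by apply/KP/(can_inj mxvecK); rewrite -NE -mulmxA mulmx_ker mulmx0 linear0.
  suff /submxP[u Du] : (vcoord k <= kermx N)%MS by exists u; rewrite -Du vcoordK.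
  by apply/sub_kermxP; rewrite NE vcoordK rk linear0.
pose G := trace_gram kap.
have kapE u v : \tr (kap (vcombine u) * kap (vcombine v)) = (u *m G *m v^T) 0 0.
  exact: trace_gramE.
have vecP (u : 'rV_l) : u *m G *m A^T = 0 -> vcombine u \in P.
  move=> uGA; apply/PP=> _ /vecA_onto[w ->].
  by rewrite kapE trmx_mul mulmxA uGA mul0mx mxE.
have kerA (u : 'rV_l) : u *m (A *m G *m A^T) = 0 -> u *m (A *m G) = 0.
  rewrite !mulmxA => /vecP uP; apply/trace_gram_ker => y.
  by rewrite kapJ ?mul0r ?linear0 //; apply/memv_capP.
have rankE : (\rank (A *m G) <= \rank (A *m G *m A^T))%N.
  have : (kermx (A *m G *m A^T) <= kermx (A *m G))%MS.
    apply/rV_subP => u /sub_kermxP /kerA uAG; exact/sub_kermxP.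
  move/mxrankS; rewrite !mxrank_ker leq_sub2lE ?rank_leq_row //.
(* By equal ranks, every functional that [L] induces on [K] is induced by an element of [K]; the one
   for [x] yields [k]. *)
have : (G *m A^T <= A *m G *m A^T)%MS.
  have sAG : (A *m G *m A^T <= G *m A^T)%MS by rewrite -mulmxA submxMl.
  rewrite -(geq_leqif (mxrank_leqif_sup sAG)); apply: leq_trans rankE.
  by rewrite -mxrank_tr trmx_mul trmxK trace_gram_sym.
move/(submx_trans (submxMl (vcoord x) _))/submxP=> [u Du].
exists (vcombine (u *m A)); split=> //; rewrite -[x in x - _]vcoordK -linearB vecP //.
by rewrite mulmxBl mulmxBl -(mulmxA (vcoord x)) Du !mulmxA subrr.
Qed.
End Leibniz.

(** * Decomposition of modules *)

Section Decomposition.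
Variables (F : fieldType) (L : vectType F) (mul : L -> L -> L).
Hypotheses (F0 : [pchar F] =i pred0) (mulP : bilinear_map mul)
  (mulL : left_leibniz mul) (ssL : leib_semisimple mul).

(** [e] projects onto the Fitting null component of [c]; it comes from a Bezout relation between a
    power of ['X] and the factor of the characteristic polynomial prime to ['X]. Were [e] of full
    rank, [c] would be nilpotent, of trace 0. *)
Lemma fitting_projection n (c : 'M[F]_n.+1) : \tr c != 0 ->
  exists e d : 'M[F]_n.+1, [/\ e + c * d = 1, c * d = d * c, exists k, e * c ^+ k = 0, ~~ row_full e
    & (forall b, b * c = c * b -> b * e = e * b)].
Proof.
move=> trc; have [k [q q0 Dp]] := multiplicity_XsubC (char_poly c) 0.
rewrite subr0 monic_neq0 ?char_poly_monic //= in q0 Dp.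
(* The exponent [k.+1] lets a factor [c] be split off even when [k] is 0. *)
have : coprimep q ('X ^+ k.+1).
  by apply: coprimep_expr; rewrite -['X]subr0 -polyC0 coprimep_XsubC.
case/Bezout_eq1_coprimepP=> -[u w] /= uw1.
have cq : horner_mx c q * c ^+ k = 0.
  rewrite -[c in c ^+ k](horner_mx_X c) -rmorphXn -rmorphM -Dp; exact: Cayley_Hamilton.
exists (horner_mx c (u * q)), (horner_mx c ('X ^+ k * w)).
have ec : horner_mx c (u * q) * c ^+ k = 0 by rewrite rmorphM -mulrA cq mulr0.
split.
- rewrite -{2}(horner_mx_X c) -rmorphM -rmorphD mulrA -exprS [_ * w]mulrC uw1.
  exact: rmorph1.
- by rewrite -{1 4}(horner_mx_X c); apply: comm_horner_mx2.
- by exists k.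
- apply: contra trc => /row_fullP[b be]; apply/eqP/(@mxtrace_nilpotent _ _ _ k).
  have ck : c ^+ k = 0 by rewrite -[c ^+ k]mul1mx -be -mulmxA [_ *m c ^+ k]ec mulmx0.
  by rewrite -[RHS]ck -iter_mulr_1.
- by move=> b bc; apply: comm_mx_horner.
Qed.

Section Submodule.
Variables (V : vectType F) (act : L -> V -> V) (U : {vspace V}).
Hypotheses (actV : module_axioms mul act) (actU : forall x v, v \in U -> act x v \in U).

Definition sub_act x (w : subvs_of U) := vsproj U (act x (vsval w)).

Lemma sub_actE x w : vsval (sub_act x w) = act x (vsval w).
Proof. by rewrite vsprojK // actU // subvsP. Qed.

Lemma sub_act_module : module_axioms mul sub_act.
Proof.
have [actP actM] := actV; split; first split.
- move=> a x y w; apply: subvs_inj.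
  by rewrite /= !sub_actE (bilDl actP) (bilZl actP).
- move=> a x y w; apply: subvs_inj.
  by rewrite /= !sub_actE /= (bilDr actP) (bilZr actP).
by move=> x y w; apply: subvs_inj; rewrite /= !sub_actE actM.
Qed.
End Submodule.

(* Elements of [L V] are sums [\sum_(p <- s) act p.1 p.2]. *)
Lemma module_decomposition (V : vectType F) (act : L -> V -> V) :
    module_axioms mul act ->
  (forall v, exists v0 (s : seq (L * V)),
     (forall x, act x v0 = 0) /\ v = v0 + \sum_(p <- s) act p.1 p.2) /\
  (forall (s : seq (L * V)) z, z = \sum_(p <- s) act p.1 p.2 ->
     (forall x, act x z = 0) -> z = 0).
Proof.
have [m] := ubnP (\dim {:V}); elim: m V act => // m IHm V act le_m mV.
have [actP actM] := mV.
case: (classic (forall x v, act x v = 0)) => [act0 | nact0].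
  split=> [v|s z -> _]; last by rewrite big1.
  by exists v, [::]; rewrite big_nil addr0.
have [x0 [v0 nz_act]] : exists x v, act x v != 0.
  apply: NNPP => H; apply: nact0 => x v; apply/eqP/negPn/negP => nz.
  by apply: H; exists x, v.
have [|n [rho [f [g [fK gK rhoP fE]]]]] := module_matrix mV.
  by exists (act x0 v0).
have [||c [c_comm trc [sc Dc]]] := casimir_exists F0 rhoP.
- by move=> x; apply: (trace_radical F0 mulP mulL ssL rhoP).
- exists x0; apply: contra_neq nz_act => rx0.
  by apply: (can_inj fK); rewrite fE rx0 mulmx0 linear0.
have [e [d [ed cd [k ek] nfull e_comm]]] := fitting_projection trc.
pose E v := g (f v *m e).
have E_lin : linear E.
  by move=> a u v; rewrite /E linearP mulmxDl -scalemxAl linearP.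
pose El : {linear V -> V} := HB.pack E (GRing.isLinear.Build F V V _ E E_lin).
(* The Casimir element acts by sums of double actions, so its image lies in [L V]; the order is
   reversed by the row-vector convention. *)
have cE u : g (u *m c) = \sum_(p <- sc) act p.2 (act p.1 (g u)).
  apply: (can_inj fK); rewrite gK Dc mulmx_sumr linear_sum; apply: eq_bigr => p _.
  by rewrite mulmxA !fE gK.
(* The Casimir element kills invariants, so they lie in its Fitting null component. *)
have E_inv v : (forall x, act x v = 0) -> E v = v.
  move=> v_inv; apply: (can_inj fK); rewrite gK.
  rewrite -[RHS]mulmx1 -[1%:M]ed mulmxDr [_ *m (c * d)]mulmxA.
  suff -> : f v *m c = 0 by rewrite mul0mx addr0.
  apply: (can_inj gK); rewrite cE fK linear0 big1 // => p _.
  by rewrite v_inv (bil0r actP).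
have E_act x v : E (act x v) = act x (E v).
  apply: (can_inj fK); rewrite gK !fE gK -!mulmxA; congr (_ *m _).
  by apply: e_comm; apply: c_comm.
pose V0 := limg (linfun El).
have EV0 v : E v \in V0 by rewrite -[E v](lfunE El) memv_img ?memvf.
have actV0 x v : v \in V0 -> act x v \in V0.
  by case/memv_imgP=> u _ ->; rewrite lfunE /= -E_act.
have ltV0 : (\dim {:subvs_of V0} < m)%N.
  have -> : \dim {:subvs_of V0} = \dim V0.
    by rewrite dimvf.
  rewrite -ltnS (leq_trans _ le_m) // ltnS ltnNge; apply: contra nfull => le_dim.
  have V0f : V0 = fullv by apply/eqP; rewrite eqEdim subvf.
  rewrite -sub1mx; apply/row_subP => i.
  have : g (row i 1%:M) \in V0 by rewrite V0f memvf.
  by case/memv_imgP=> u _; rewrite lfunE => /(can_inj gK) ->; rewrite submxMl.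
pose act0 := sub_act act (U := V0).
have act0E x w : vsval (act0 x w) = act x (vsval w) by apply: sub_actE.
have [dec0 cap0] := IHm _ act0 ltV0 (sub_act_module mV actV0).
(* [v] is [E v], decomposed by induction in [V0], plus a vector in the image of the Casimir
   element. *)
split=> [v|s z Ds z_inv].
  have [w0 [s0 [w0_inv Dw]]] := dec0 (vsproj V0 (E v)).
  exists (vsval w0), ([seq (p.1, vsval p.2) | p <- s0] ++
    [seq (p.2, act p.1 (g (f v *m d))) | p <- sc]).
  split=> [x|]; first by rewrite -act0E w0_inv linear0.
  rewrite big_cat /= !big_map /= addrA -cE.
  have -> : vsval w0 + \sum_(p <- s0) act p.1 (vsval p.2) = E v.
    rewrite -[RHS](vsprojK (EV0 v)) Dw linearD linear_sum /=; congr (_ + _).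
    by apply: eq_bigr => p _; rewrite act0E.
  rewrite /E -linearD -!mulmxA -mulmxDr.
  by rewrite -[d *m c]cd [e + _]ed mulmx1 fK.
(* [E] fixes [z] and commutes with the action, which brings the whole sum into [V0]. *)
have Dz : z = \sum_(p <- s) act p.1 (E p.2).
  rewrite -(E_inv z z_inv) -[E z]/(El z) Ds linear_sum; apply: eq_bigr => p _.
  exact: E_act.
have Dz0 : z = vsval (\sum_(p <- [seq (p.1, vsproj V0 (E p.2)) | p <- s]) act0 p.1 p.2).
  by rewrite Dz linear_sum big_map; apply: eq_bigr => p _; rewrite /= act0E vsprojK.
rewrite Dz0 (cap0 _ _ erefl) ?linear0 // => x; apply: subvs_inj.
by rewrite /= act0E -Dz0 z_inv.
Qed.

Lemma submodule_decomposition (V : vectType F) (act : L -> V -> V) (U : {vspace V}) :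
    module_axioms mul act -> (forall x v, v \in U -> act x v \in U) ->
  {in U, forall v, exists v0 (s : seq (L * V)),
    [/\ v0 \in U, forall x, act x v0 = 0, {in s, forall p, p.2 \in U}
      & v = v0 + \sum_(p <- s) act p.1 p.2]}.
Proof.
move=> mV actU v vU.
have [/(_ (vsproj U v))[w0 [s [w0_inv Dw]]] _] :=
  module_decomposition (sub_act_module mV actU).
exists (vsval w0), [seq (p.1, vsval p.2) | p <- s]; split=> [|x|_ /mapP[p _ ->]|].
- exact: subvsP.
- by rewrite -sub_actE // w0_inv linear0.
- exact: subvsP.
rewrite -{1}(vsprojK vU) Dw linearD linear_sum big_map /=; congr (_ + _).
by apply: eq_bigr => p _; rewrite sub_actE.
Qed.

End Decomposition.

(** * Vanishing of cohomology *)

Lemma linfun_linearE (F : fieldType) (U V : vectType F) (f : U -> V) :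
  linear f -> linfun f =1 f.
Proof.
by move=> f_lin; exact: (lfunE (HB.pack f (GRing.isLinear.Build F U V _ f f_lin) : {linear U -> V})).
Qed.

Section HomModule.
Variables (F : fieldType) (L V : vectType F) (mul : L -> L -> L) (act : L -> V -> V).
Hypotheses (mulP : bilinear_map mul) (mulL : left_leibniz mul) (actV : module_axioms mul act).

Definition hom_act x (f : 'Hom(L, V)) : 'Hom(L, V) :=
  linfun (fun y => act x (f y) - f (mul x y)).

Lemma hom_actE x f y : hom_act x f y = act x (f y) - f (mul x y).
Proof.
rewrite linfun_linearE // => a u v; have [actP _] := actV.
rewrite linearP (bilDr actP) (bilZr actP) (bilDr mulP) (bilZr mulP) linearP.
by rewrite scalerBr opprD addrACA.
Qed.

Lemma hom_act_module : module_axioms mul hom_act.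
Proof.
have [actP actM] := actV; split; first split.
- move=> a x y f; apply/lfunP=> z; rewrite add_lfunE scale_lfunE !hom_actE.
  rewrite (bilDl actP) (bilZl actP) (bilDl mulP) (bilZl mulP) linearP.
  by rewrite scalerBr opprD addrACA.
- move=> a f g x; apply/lfunP=> z; rewrite add_lfunE scale_lfunE !hom_actE.
  rewrite !add_lfunE !scale_lfunE (bilDr actP) (bilZr actP).
  by rewrite scalerBr opprD addrACA.
move=> x y f; apply/lfunP=> z; rewrite add_lfunE opp_lfunE !hom_actE actM !(bilBr actP).
rewrite (_ : mul (mul x y) z = mul x (mul y z) - mul y (mul x z)); last by rewrite mulL addrK.
rewrite linearB /= !opprB.
rewrite [RHS]addrACA !addrA !subrK -!addrA; congr (_ + _).
by rewrite addrCA [RHS]addrCA; congr (_ + _); rewrite addrC.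
Qed.
End HomModule.

Section Cochains.
Variables (F : fieldType) (L M : vectType F) (mul : L -> L -> L) (lact : L -> M -> M).
Hypotheses (mulP : bilinear_map mul) (mulL : left_leibniz mul)
  (lactM : module_axioms mul lact).

(** Currying keeps cochain spaces finite-dimensional and gives the module structure by iterating
    [hom_act]. *)
Fixpoint cochain n : vectType F := if n is m.+1 then 'Hom(L, cochain m) else M.

Fixpoint cochain_act n : L -> cochain n -> cochain n :=
  if n is m.+1 then hom_act mul (@cochain_act m) else lact.

(* The recursion is Cartan's formula [i_x d = theta_x - d i_x], where [theta] is *)
(* [cochain_act] and [i_x] inserts [x] as first argument.                        *)
Fixpoint cochain_d n : cochain n -> cochain n.+1 :=
  if n is m.+1 then fun f => linfun (fun x => cochain_act x f - cochain_d (f x))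
  else fun v => linfun (fun x => lact x v).

Lemma cochain_module n : module_axioms mul (@cochain_act n).
Proof. by elim: n => //= n IHn; apply: hom_act_module. Qed.

Lemma cochain_actS n x (f : cochain n.+1) y :
  cochain_act x f y = cochain_act x (f y) - f (mul x y).
Proof. by apply: hom_actE => //; apply: cochain_module. Qed.

Lemma cochain_d0 v x : cochain_d (n := 0) v x = lact x v.
Proof. by rewrite linfun_linearE // => a y z; apply: lactM.1.1. Qed.

(** Proved jointly: [linfun] returns the given function only if it is linear, so the formula in one
    degree needs linearity in the degree below. *)
Lemma cochain_d_linearS n : linear (@cochain_d n) /\
  forall (f : cochain n.+1) x, cochain_d f x = cochain_act x f - cochain_d (f x).
Proof.
have S m : linear (@cochain_d m) ->
    forall (f : cochain m.+1) x, cochain_d f x = cochain_act x f - cochain_d (f x).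
  move=> d_lin f x; have [actP _] := cochain_module m.+1.
  rewrite -[LHS]/(linfun (fun y => cochain_act y f - cochain_d (f y)) x).
  rewrite linfun_linearE // => a y z; rewrite linearP d_lin.
  by rewrite (bilDl actP) (bilZl actP) scalerBr opprD addrACA.
suff d_lin : linear (@cochain_d n) by split=> //; apply: S.
elim: n => [|n IHn] a f g; apply/lfunP=> x; rewrite add_lfunE scale_lfunE.
  by rewrite !cochain_d0 (bilDr lactM.1) (bilZr lactM.1).
have [actP _] := cochain_module n.+1.
rewrite !S // (bilDr actP) (bilZr actP) add_lfunE scale_lfunE IHn.
by rewrite scalerBr opprD addrACA.
Qed.

Lemma cochain_d_linear n : linear (@cochain_d n).
Proof. by case: (cochain_d_linearS n). Qed.
HB.instance Definition _ n :=
  GRing.isLinear.Build F (cochain n) (cochain n.+1) _ (@cochain_d n) (@cochain_d_linear n).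

Lemma cochain_dB n (f g : cochain n) : cochain_d (f - g) = cochain_d f - cochain_d g.
Proof. exact: linearB. Qed.

Lemma cochain_dS n (f : cochain n.+1) x :
  cochain_d f x = cochain_act x f - cochain_d (f x).
Proof. by case: (cochain_d_linearS n). Qed.

Lemma cochain_d_act n x (f : cochain n) :
  cochain_d (cochain_act x f) = cochain_act x (cochain_d f).
Proof.
elim: n x f => [|n IHn] x f; apply/lfunP=> y.
  rewrite (cochain_actS (n := 0)) !cochain_d0 /= lactM.2.
  by rewrite opprB addrC subrK.
rewrite (cochain_dS (n := n)) (cochain_actS (n := n.+1)) !(cochain_dS (n := n)).
rewrite cochain_actS cochain_dB IHn.
have [actP actM] := cochain_module n.+1; rewrite actM (bilBr actP) !opprB.
rewrite [X in _ = _ + X]addrCA [RHS]addrCA; congr (_ + _).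
by rewrite [RHS]addrC addrA subrK.
Qed.

Lemma cochain_d_vanish n (f : cochain n) :
    [pchar F] =i pred0 -> leib_semisimple mul ->
    (forall v : M, (forall x, lact x v = 0) -> v = 0) ->
    cochain_d f = 0 ->
  (if n is m.+1 return cochain n -> Prop then fun f => exists g : cochain m, f = cochain_d g
   else fun f => f = 0) f.
Proof.
move=> F0 ssL invM; elim: n f => [|n IHn] f df0.
  by apply: invM => x; rewrite -cochain_d0 df0 zero_lfunE.
have inv_exact (f0 : cochain n.+1) : (forall x, cochain_act x f0 = 0) ->
    (forall x, cochain_d (f0 x) = 0) -> exists g0 : cochain n, f0 = cochain_d g0.
  move=> {f df0} f0_inv df0x; move: n IHn f0 f0_inv df0x; case=> [|n] IHn f0 f0_inv df0x.
    by exists 0; rewrite linear0; apply/lfunP=> x; rewrite zero_lfunE; apply: IHn.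
  (* By induction the values of [f0] are coboundaries, so [h] lifts [f0] linearly through [d]; it
     need not be invariant, hence the passage to its invariant part [h0]. *)
  pose D := linfun (@cochain_d n); pose h : cochain n.+1 := (D^-1 \o f0)%VF.
  have Dh x : cochain_d (h x) = f0 x.
    rewrite -[LHS](lfunE (cochain_d (n := n))) comp_lfunE limg_lfunVK //.
    by have [g ->] := IHn _ (df0x x); rewrite -[cochain_d g]lfunE memv_img ?memvf.
  have [dec_h _] := module_decomposition F0 mulP mulL ssL (cochain_module n.+1).
  have [h0 [t [h0_inv Dt]]] := dec_h h.
  have [_ cap] := module_decomposition F0 mulP mulL ssL (cochain_module n.+2).
  pose Dc (g : cochain n.+1) : cochain n.+2 := (D \o g)%VF.
  have DcE g x : Dc g x = cochain_d (g x) by rewrite comp_lfunE lfunE.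
  have Dc_lin : linear Dc.
    move=> a g1 g2; apply/lfunP=> x; rewrite add_lfunE scale_lfunE !DcE.
    by rewrite add_lfunE scale_lfunE cochain_d_linear.
  pose DcL : {linear cochain n.+1 -> cochain n.+2} :=
    HB.pack Dc (GRing.isLinear.Build F _ _ _ Dc Dc_lin).
  have Dc_act x g : Dc (cochain_act x g) = cochain_act x (Dc g).
    apply/lfunP=> y; rewrite DcE (cochain_actS (n := n.+1)) !DcE.
    by rewrite (cochain_actS (n := n)) cochain_dB cochain_d_act.
  (* [f0 - Dc h0] is invariant, and it is also the image of the part of [h] generated by the action,
     so it is 0. *)
  have f0E : f0 = Dc h0.
    apply/eqP; rewrite -subr_eq0; apply/eqP.
    apply: (cap [seq (p.1, Dc p.2) | p <- t]) => [|x].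
      rewrite big_map (eq_bigr (fun p => DcL (cochain_act p.1 p.2))); last first.
        by move=> p _; rewrite -[LHS]/(cochain_act p.1 (Dc p.2)) -Dc_act.
      have -> : f0 = DcL h by apply/lfunP=> x; rewrite -[RHS]/(Dc h x) DcE Dh.
      by rewrite -linear_sum -[Dc h0]/(DcL h0) -linearB Dt [h0 + _]addrC addrK.
    rewrite (bilBr (cochain_module n.+2).1) f0_inv -Dc_act h0_inv.
    by rewrite (_ : Dc 0 = 0) ?subrr //; apply: (linear0 DcL).
  (* For invariant [h0] Cartan's formula reads [d h0 x = - d (h0 x)], whence the sign. *)
  exists (- h0); rewrite linearN; apply/lfunP => x.
  by rewrite opp_lfunE cochain_dS h0_inv sub0r opprK f0E DcE.
pose Z := lker (linfun (@cochain_d n.+1)).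
have ZP (h : cochain n.+1) : h \in Z = (cochain_d h == 0) by rewrite memv_ker lfunE.
have ZactP x (h : cochain n.+1) : h \in Z -> cochain_act x h \in Z.
  by rewrite !ZP cochain_d_act => /eqP->; rewrite (bil0r (cochain_module n.+2).1).
have [|f0 [s [f0Z f0_inv sZ Df]]] :=
  submodule_decomposition F0 mulP mulL ssL (cochain_module n.+1) ZactP (x := f).
  by rewrite ZP df0.
(* By Cartan's formula [theta_x h = d (h x)] for every cocycle [h], so only the *)
(* invariant part [f0] of [f] matters.                                          *)
have ds (h : cochain n.+1) x : h \in Z -> cochain_act x h = cochain_d (h x).
  by rewrite ZP => /eqP dh; apply/eqP; rewrite -subr_eq0 -cochain_dS dh zero_lfunE.
have df0x x : cochain_d (f0 x) = 0 by rewrite -ds.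
have [g0 Df0] := inv_exact f0 f0_inv df0x.
exists (g0 + \sum_(p <- s) p.2 p.1); rewrite linearD linear_sum Df Df0; congr (_ + _).
by rewrite !big_seq; apply: eq_bigr => p ps; apply: ds; apply: sZ.
Qed.
End Cochains.

(** * Multilinear maps as cochains *)

Section Evaluation.
Variables (F : fieldType) (L M : vectType F) (mul : L -> L -> L)
  (lact : L -> M -> M) (ract : M -> L -> M).
Hypotheses (mulP : bilinear_map mul) (mulL : left_leibniz mul)
  (lactM : module_axioms mul lact).
Local Notation cochain := (cochain L M).
Local Notation cobound := (cobound mul lact ract).

Fixpoint ev n : cochain n -> seq L -> M :=
  if n is m.+1 then fun f s => ev (f (head 0 s)) (behead s) else fun v _ => v.

Fixpoint curry n (f : seq L -> M) : cochain n :=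
  if n is m.+1 then linfun (fun x => curry m (fun s => f (x :: s))) else f [::].

Lemma ev_linear n s : linear (fun f : cochain n => ev f s).
Proof.
elim: n s => [|n IHn] s a f g //=.
by rewrite add_lfunE scale_lfunE; apply: IHn.
Qed.

Lemma evB n (f g : cochain n) s : ev (f - g) s = ev f s - ev g s.
Proof. by rewrite addrC -scaleN1r ev_linear scaleN1r addrC. Qed.

Lemma ev_inj n (f g : cochain n) : (forall s, size s = n -> ev f s = ev g s) -> f = g.
Proof.
elim: n f g => [|n IHn] f g fg; first exact: (fg [::]).
apply/lfunP=> x; apply: IHn => s sn; by apply: (fg (x :: s)); rewrite /= sn.
Qed.

Lemma ev_multilinear n (f : cochain n) : multilinear n (ev f).
Proof.
elim: n f => [|n IHn] f [|x s] //= [sn] [|i] lt_in a y z /=.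
  by rewrite linearP ev_linear.
exact: IHn.
Qed.

Lemma multilinear_cons n (f : seq L -> M) x :
  multilinear n.+1 f -> multilinear n (fun s => f (x :: s)).
Proof.
move=> fM s sn i lt_in a y z.
by apply: (fM (x :: s) _ i.+1); rewrite //= sn.
Qed.

Lemma curryK n (f : seq L -> M) s : multilinear n f -> size s = n -> ev (curry n f) s = f s.
Proof.
elim: n f s => [|n IHn] f [|x s] //= fM [sn].
rewrite linfun_linearE; first by apply: IHn => //; apply: multilinear_cons.
move=> a y z; apply: ev_inj => t tn; rewrite ev_linear !IHn //; try exact: multilinear_cons.
by apply: (fM (0 :: t) _ 0); rewrite //= tn.
Qed.

Lemma ev_act n x (f : cochain n) s : size s = n ->
  ev (cochain_act mul lact x f) s =
    lact x (ev f s) - \sum_(j < n) ev f (set_nth 0 s j (mul x (nth 0 s j))).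
Proof.
elim: n f s => [|n IHn] f [|y s] //= => [_|[sn]]; first by rewrite big_ord0 subr0.
rewrite (cochain_actS mulP mulL lactM) evB IHn // big_ord_recl /=.
by rewrite opprD addrAC addrA.
Qed.

(** Cartan's formula for [cobound]: the terms with [i = 0] give the action of [x], and the others,
    after an index shift that flips the sign, the coboundary with [x] inserted. *)
Lemma cobound_cons n (f : seq L -> M) x s : size s = n.+1 ->
  cobound n.+1 f (x :: s) = lact x (f s)
    - \sum_(j < n.+1) f (set_nth 0 s j (mul x (nth 0 s j)))
    - cobound n (fun r => f (x :: r)) s.
Proof.
move=> sn; have signS i (v : M) : ((-1) ^+ i.+1 : F) *: v = - (((-1) ^+ i : F) *: v).
  by rewrite exprS mulN1r scaleNr.
have rem0 (y : L) t : rem_at 0 (y :: t) = t by rewrite /rem_at /= drop0.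
rewrite /Defs.cobound big_ord_recl [X in _ + X]big_ord_recl.
have -> : \sum_(j < n.+2 | ((ord0 : 'I_n.+2) < j)%N) ((-1) ^+ (ord0 : 'I_n.+2).+1 : F) *:
      f (rem_at (ord0 : 'I_n.+2) (set_nth 0 (x :: s) j
        (mul (nth 0 (x :: s) (ord0 : 'I_n.+2)) (nth 0 (x :: s) j))))
    = - \sum_(j < n.+1) f (set_nth 0 s j (mul x (nth 0 s j))).
  rewrite big_mkcond big_ord_recl; apply: etrans (add0r _) _; rewrite -sumrN; apply: eq_bigr => j _.
  by rewrite /= expr1 scaleN1r rem0.
have -> : \sum_(i < n.+1) \sum_(j < n.+2 | (lift ord0 i < j)%N)
      ((-1) ^+ (lift ord0 i).+1 : F) *: f (rem_at (lift ord0 i) (set_nth 0 (x :: s) j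
        (mul (nth 0 (x :: s) (lift ord0 i)) (nth 0 (x :: s) j))))
    = - \sum_(i < n.+1) \sum_(j < n.+1 | (i < j)%N) ((-1) ^+ i.+1 : F) *:
        f (x :: rem_at i (set_nth 0 s j (mul (nth 0 s i) (nth 0 s j)))).
  rewrite -sumrN; apply: eq_bigr => i _; rewrite big_mkcond big_ord_recl.
  apply: etrans (add0r _) _; rewrite [in RHS]big_mkcond -sumrN; apply: eq_bigr => j _.
  by rewrite /= ltnS; case: ifP => _; rewrite ?oppr0 // signS.
have -> : \sum_(i < n) ((-1) ^+ lift ord0 i : F) *:
      lact (nth 0 (x :: s) (lift ord0 i)) (f (rem_at (lift ord0 i) (x :: s)))
    = - \sum_(i < n) ((-1) ^+ i : F) *: lact (nth 0 s i) (f (x :: rem_at i s)).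
  by rewrite -sumrN; apply: eq_bigr => i _; rewrite signS.
rewrite expr0 scale1r rem0 [_ *: ract _ _]signS /= !opprD -!addrA.
by congr (_ + _); rewrite [RHS]addrCA; congr (_ + _); rewrite addrCA.
Qed.

Lemma eq_cobound n (f g : seq L -> M) s : (forall r, size r = n -> f r = g r) ->
  size s = n.+1 -> cobound n f s = cobound n g s.
Proof.
move=> fg sn; have rem_size i t : (i < n.+1)%N -> size t = n.+1 -> size (rem_at i t) = n.
  move=> lt_in tn; rewrite /rem_at size_cat size_take size_drop tn lt_in.
  by rewrite subSS subnKC.
congr (_ + _ + _).
- by apply: eq_bigr => i _; rewrite fg // rem_size // (leqW (ltn_ord i)).
- by rewrite fg // size_take sn ltnSn.
apply: eq_bigr => i _; apply: eq_bigr => j _; rewrite fg // rem_size //.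
by rewrite size_set_nth sn; apply/maxn_idPr.
Qed.

(** Both differentials satisfy the same recursion; symmetry enters in degree 0, where [cobound] uses
    the right action. *)
Lemma ev_cochain_d n (f : cochain n) s : (forall v x, ract v x = - lact x v) ->
  size s = n.+1 -> ev (cochain_d mul lact f) s = cobound n (ev f) s.
Proof.
move=> sym; elim: n f s => [|n IHn] f [|x s] //= [sn].
  case: s sn => // _; rewrite /Defs.cobound big_ord0 add0r expr1 scaleN1r /= sym opprK.
  rewrite big1 ?addr0 => [|i _]; first exact: (cochain_d0 lactM f x).
  by rewrite big_pred0 // => j; rewrite !ord1.
rewrite cobound_cons // -[X in _ - X]/(cobound n (ev (f x)) s) -IHn //.
rewrite -[LHS]/(ev (n := n.+1) (cochain_d mul lact f x) s).
by rewrite (cochain_dS mulP mulL lactM) evB (ev_act x (n := n.+1)).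
Qed.

End Evaluation.

Theorem theorem4p2 (F : fieldType) (L M : vectType F)
  (mul : L -> L -> L) (lact : L -> M -> M) (ract : M -> L -> M) :
  [pchar F] =i pred0 ->
  bilinear_map mul ->
  left_leibniz mul ->
  leib_semisimple mul ->
  bimodule_axioms mul lact ract ->
  right_invariants_trivial ract ->
  forall n : nat, HL_vanishes mul lact ract n.
Proof.
move=> F0 mulP mulL ssL [lactP [ractP [Mll [Mlr Mrl]]]] invM n f fM df.
have lactM : module_axioms mul lact by split.
(* [x.m + m.x] is right invariant, so [M] is symmetric. *)
have sym v x : ract v x = - lact x v.
  apply/eqP; rewrite -addr_eq0; apply/eqP/invM => y.
  by rewrite (bilDl ractP) Mlr Mrl addrA subrK subrr.
have inv_l v : (forall x, lact x v = 0) -> v = 0.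
  by move=> v0; apply: invM => x; rewrite sym v0 oppr0.
have dc0 : cochain_d mul lact (curry n f) = 0.
  apply: ev_inj => s sn; rewrite (ev_cochain_d mulP mulL lactM _ sym) //.
  rewrite (@eq_cobound _ _ _ _ _ _ _ _ f) ?df //; last by move=> r; apply: curryK.
  by rewrite -(subrr (0 : cochain L M n.+1)) evB subrr.
have := cochain_d_vanish mulP mulL lactM F0 ssL inv_l dc0.
case: n fM df {dc0} => [|n] fM df.
  by move=> f0 [|//] _; apply: f0.
case=> g Dg; exists (ev g); split; first exact: ev_multilinear.
by move=> s sn; rewrite -(ev_cochain_d mulP mulL lactM _ sym) // -Dg curryK.
Qed.
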